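(* Let $\Omega\subset\mathbb{R}^3$ be a bounded, connected, open set with Lipschitz boundary. Let $(s^a,m^a)$, $a=1,\dots,A$, be pairs of orthogonal unit vectors of $\mathbb{R}^3$ (slip systems) and let $p^a>0$, $a=1,\dots,A$, be given numbers. Let $\Psi_i\colon\mathbb{R}^{3\times3}\to\mathbb{R}$ be a Lipschitz continuous function with sublinear growth at infinity such that, for all $a,b\in\{1,\dots,A\}$ and $\xi\in\mathbb{R}$, the mapping $$s\mapsto\Psi_i\big(s\otimes m^a+\xi(m^a\times m^b)\otimes m^b\big),\qquad s\in\{m^a\}^\perp,$$ is periodic on $\{m^a\}^\perp$ with vector period $p^as^a$. For each crystallographic structured deformation $(g,G)$ of $\Omega$ define $\Psi_g\colon\Omega\times\mathbb{R}^{3\times3}\to\mathbb{R}$ by $\Psi_g(x,L):=\Psi_i\big((\nabla g(x))^{-1}L\big)$, and for $u\in SBV(\Omega;\mathbb{R}^3)$ and $r>0$ set $$E_g^{\alpha_r}(u):=\int_{\Omega_r}\Psi_g\big(x,(D^su*\alpha_r)(x)\big)\,dx,$$ where $\alpha_r(x)=r^{-3}\alpha(x/r)$ with $\alpha\in C_c^\infty(\mathbb{R}^3)$, $\operatorname{spt}\alpha\subset B_1$, $\int_{B_1}\alpha\,dx=1$. Then, for every crystallographic structured deformation $(g,G)$, the upscaled energy $I^{\alpha_r}(g,G;\Omega_r):=\lim_{n\to\infty}E_g^{\alpha_r}(u_n)$, for any $(u_n)\in\mathsf{Ad}(g,G)$, is given by $$I^{\alpha_r}(g,G;\Omega_r)=\int_{\Omega_r}\Psi_g\big(x,((\nabla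 g-G)*\alpha_r)(x)\big)\,dx,$$ and the spatially localized upscaled energy is $$I(g,G):=\lim_{r\to0^+}I^{\alpha_r}(g,G;\Omega_r)=\int_\Omega\Psi_g\big(x,\nabla g(x)-G(x)\big)\,dx=\int_\Omega\Psi_i\big(I-(\nabla g(x))^{-1}G(x)\big)\,dx=\int_\Omega\Psi_i\big(I-K_{(g,G)}(x)\big)\,dx=\int_\Omega\Psi_i\big(M_{(i,K_{(g,G)})}(x)\big)\,dx .$$ In particular, the bulk density of $I(g,G)$ is frame-indifferent (the density $x\mapsto\Psi_i(M_{(i,K_{(g,G)})}(x))$ is unchanged when $\nabla g$ and $G$ are both premultiplied by a rotation) and, as a function $\Psi_i$ of $M_{(i,K_{(g,G)})}$, retains the periodicity property above.
   Context: $\Omega_r:=\{x\in\Omega:\operatorname{dist}(x,\partial\Omega)>r\}$, $B_1$ is the open unit ball of $\mathbb{R}^3$, $I$ is the identity matrix. Sublinear growth at infinity means $\Psi_i(\xi)/|\xi|\to0$ as $|\xi|\to\infty$, so that the recession function of $\Psi_i$ vanishes. For $u\in SBV(\Omega;\mathbb{R}^3)$, $Du=\nabla u\,\mathcal L^3+D^su$ with $D^su=[u]\otimes\nu_u\,\mathcal H^2\llcorner S_u$. Convolution over $\Omega$: $(\mu*\alpha_r)(x)=\int_\Omega\alpha_r(x-y)\,d\mu(y)$ and $f*\alpha_r=(f\mathcal L^3)*\alpha_r$. Invertible structured deformation of $\Omega$: a pair $(g,G)\in SBV(\Omega;\mathbb{R}^3)\times L^1(\Omega;\mathbb{R}^{3\times3})$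 such that (I1) $g$ is a diffeomorphism of class $C^1$ with $\nabla g$ and $(\nabla g)^{-1}$ Lipschitz; (I2) $G$ is continuous on $\overline\Omega$ with invertible values; (I3) $\det\nabla g=\det G$. For such $(g,G)$ set $K_{(g,G)}:=(\nabla g)^{-1}G$ and $M_{(i,K_{(g,G)})}:=I-K_{(g,G)}=(\nabla g)^{-1}(\nabla g-G)$. $(g,G)$ is crystallographic (with respect to the slip systems) if it is an invertible structured deformation and there are functions $\gamma^a\colon\Omega\to\mathbb{R}$, $a=1,\dots,A$, such that $I-K_{(g,G)}(x)=\sum_{a=1}^A\gamma^a(x)\,s^a\otimes m^a$ for all $x\in\Omega$. $\mathsf{Ad}(g,G)$ is the set of sequences $(u_n)\subset SBV(\Omega;\mathbb{R}^3)$ with $u_n\to g$ in $L^1(\Omega;\mathbb{R}^3)$, $\nabla u_n\mathcal L^3$ converging weakly-* to $G\mathcal L^3$ and $D^su_n$ converging weakly-* to $(\nabla g-G)\mathcal L^3+D^sg$ in the space $\mathcal M(\Omega;\mathbb{R}^{3\times3})$ of finite Radon measures (tested against $C_0(\Omega)$). *)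

(* Defs.v *)
From HB Require Import structures.
From mathcomp Require Import all_boot all_order all_algebra.
From mathcomp Require Import all_classical all_reals all_analysis.
Set Implicit Arguments.
Unset Strict Implicit.
Unset Printing Implicit Defensive.
Import Order.TTheory GRing.Theory Num.Theory.
Import numFieldTopology.Exports numFieldNormedType.Exports.
Local Open Scope classical_set_scope.
Local Open Scope ring_scope.

(* Points of R^3 are column vectors, so that matrices act on the left.  Maps
   defined on a set Om are represented by total maps whose values outside of Om
   are never used.  The library norm of matrices is the sup norm; it is only
   used where all norms are interchangeable (continuity, Lipschitz and growth
   conditions).  Balls, distances and diameters are Euclidean. *)

Section measurable_colvec.
Context {R : realType} (n : nat).

Let coors : 'I_n -> 'cV[R]_n -> R := fun i x => x i 0.

Let colvec_set0 : g_sigma_preimage coors set0.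
Proof. exact: sigma_algebra0. Qed.

Let colvec_setC A : g_sigma_preimage coors A -> g_sigma_preimage coors (~` A).
Proof. exact: sigma_algebraC. Qed.

Let colvec_bigcup (F : (set 'cV[R]_n)^nat) :
  (forall i, g_sigma_preimage coors (F i)) ->
  g_sigma_preimage coors (\bigcup_i (F i)).
Proof. exact: sigma_algebra_bigcup. Qed.

(* The sigma-algebra generated by the coordinates, i.e. the Borel one. *)
HB.instance Definition _ := @isMeasurable.Build default_measure_display
  'cV[R]_n (g_sigma_preimage coors) colvec_set0 colvec_setC colvec_bigcup.

Lemma measurable_fun_colvec d (T : measurableType d) (f : T -> 'cV[R]_n) :
  (forall i, measurable_fun [set: T] (fun x => f x i 0)) ->
  measurable_fun [set: T] f.
Proof.
move=> mf _ B mB; rewrite setTI; move: B mB.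
have : <<s \big[setU/set0]_(i < n)
    preimage_set_system setT (coors i) measurable >> `<=`
    image_set_system setT f measurable.
  apply: smallest_sub.
    by apply: sigma_algebra_image; exact: sigma_algebra_measurable.
  rewrite -bigcup_seq; apply: bigcup_sub => i _ _ [B mB <-].
  by rewrite /image_set_system/= !setTI; have := mf i measurableT B mB;
    rewrite setTI.
by move=> + B mB => /(_ B mB); rewrite /image_set_system /= setTI.
Qed.

End measurable_colvec.

Section euclidean.
Context {R : realType}.
Implicit Types x y v w : 'cV[R]_3.

Definition dot v w : R := \sum_i v i 0 * w i 0.
Definition enorm v : R := Num.sqrt (dot v v).
Definition eball x (r : R) : set 'cV[R]_3 := [set y | enorm (y - x) < r].

Definition tens v w : 'M[R]_3 := v *m w^T.

(* 'I_3 carries addition modulo 3. *)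
Definition cross v w : 'cV[R]_3 :=
  \col_i (v (i + 1) 0 * w (i + 1 + 1) 0 - v (i + 1 + 1) 0 * w (i + 1) 0).

Definition boundary (Om : set 'cV[R]_3) := closure Om `\` interior Om.

Definition dist_set x (A : set 'cV[R]_3) : \bar R :=
  ereal_inf [set (enorm (x - y))%:E | y in A].

Definition inner (Om : set 'cV[R]_3) (r : R) : set 'cV[R]_3 :=
  [set x | Om x /\ (r%:E < dist_set x (boundary Om))%E].

(* Near each boundary point, after a linear isometry, Om is the region above
   the graph of a Lipschitz function of two variables. *)
Definition lipschitz_boundary (Om : set 'cV[R]_3) : Prop :=
  forall x0, boundary Om x0 -> exists r (Q : 'M[R]_3) (h : R * R -> R),
    [/\ 0 < r, Q^T *m Q = 1%:M, lipschitz h &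
     forall y, eball x0 r y ->
       let z := Q *m y in
       Om y <-> h (z ord0 0, z (inord 1) 0) < z ord_max 0].

Definition colvec3 (q : R * R * R) : 'cV[R]_3 :=
  \col_i tnth [tuple q.1.1; q.1.2; q.2] i.

Lemma measurable_colvec3 : measurable_fun [set: R * R * R] colvec3.
Proof.
apply: measurable_fun_colvec => -[[|[|[|//]]] hi].
- rewrite [X in measurable_fun _ X](_ : _ = fst \o fst).
    exact: measurableT_comp.
  by apply/funext => q; rewrite mxE (tnth_nth 0).
- rewrite [X in measurable_fun _ X](_ : _ = snd \o fst).
    exact: measurableT_comp.
  by apply/funext => q; rewrite mxE (tnth_nth 0).
- rewrite [X in measurable_fun _ X](_ : _ = snd) //.
  by apply/funext => q; rewrite mxE (tnth_nth 0).
Qed.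

Definition leb3 : set 'cV[R]_3 -> \bar R :=
  pushforward
    ((@lebesgue_measure R \x @lebesgue_measure R) \x @lebesgue_measure R)%E
    colvec3.

HB.instance Definition _ := Measure.copy leb3
  (measure_function_pushforward__canonical__measure_function_Measure
     ((@lebesgue_measure R \x @lebesgue_measure R) \x @lebesgue_measure R)%E
     measurable_colvec3).

End euclidean.

Section hausdorff.
Context {R : realType}.
Implicit Types A : set 'cV[R]_3.
Local Open Scope ereal_scope.

Definition ediam A : \bar R :=
  ereal_sup (0 |` [set (enorm (q.1 - q.2))%:E | q in A `*` A]).

Definition diam_cover (delta : R) A := [set F : (set 'cV[R]_3)^nat |
  A `<=` \bigcup_k F k /\ forall k, ediam (F k) <= delta%:E].

(* omega_2 (diam / 2)^2, with omega_2 = pi the area of the unit disc. *)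
Definition area_gauge A : \bar R := (pi / 4)%:E * ediam A ^+ 2.

Definition hausdorff_pre (delta : R) A : \bar R :=
  ereal_inf [set \sum_(k <oo) area_gauge (F k) | F in diam_cover delta A].

Definition hausdorff2 A : \bar R :=
  ereal_sup [set hausdorff_pre delta A | delta in [set x | (0 < x)%R]].

Lemma ediam_ge0 A : 0 <= ediam A.
Proof. by apply: ereal_sup_ubound; left. Qed.

Lemma ediam0 : ediam set0 = 0.
Proof.
rewrite /ediam (_ : [set _ | _ in _] = set0) ?setU0 ?ereal_sup1//.
by apply/seteqP; split => // _ [[a b] [//]].
Qed.

Lemma area_gauge_ge0 A : 0 <= area_gauge A.
Proof.
apply: mule_ge0; last by rewrite expe2 mule_ge0 ?ediam_ge0.
by rewrite lee_fin divr_ge0 ?pi_ge0.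
Qed.

Lemma area_gauge0 : area_gauge set0 = 0.
Proof. by rewrite /area_gauge ediam0 expe2 mul0e mule0. Qed.

Lemma hausdorff_pre_ge0 delta A : 0 <= hausdorff_pre delta A.
Proof.
apply: le_ereal_inf_tmp => _ [F _ <-].
by apply: nneseries_ge0 => *; exact: area_gauge_ge0.
Qed.

Lemma le_hausdorff_pre delta :
  {homo hausdorff_pre delta : A B / A `<=` B >-> A <= B}.
Proof.
move=> A B AB; apply/ereal_inf_le_tmp => _ [F [BF dF] <-].
by exists F => //; split => //; apply: subset_trans BF.
Qed.

Lemma hausdorff_pre_sigma_subadditive delta :
  sigma_subadditive (hausdorff_pre delta).
Proof.
move=> A; have [[i ioo]|] := pselect (exists i, hausdorff_pre delta (A i) = +oo).
  rewrite (eseries_pinfty _ _ ioo) ?leey// => n _.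
  by rewrite -ltNye (lt_le_trans _ (hausdorff_pre_ge0 _ _)).
rewrite -forallNE => Aoo.
suff add2e (e : {posnum R}) : hausdorff_pre delta (\bigcup_n A n) <=
    \sum_(i <oo) hausdorff_pre delta (A i) + e%:num%:E.
  by apply/lee_addgt0Pr => _/posnumP[].
rewrite (le_trans _ (epsilon_trick _ _ _))//; last first.
  by move=> n; exact: hausdorff_pre_ge0.
pose P n (B : (set 'cV[R]_3)^nat) := diam_cover delta (A n) B /\
  \sum_(k <oo) area_gauge (B k) <=
  hausdorff_pre delta (A n) + (e%:num / (2 ^ n.+1)%:R)%:E.
have [G PG] : {G : ((set 'cV[R]_3)^nat)^nat & forall n, P n (G n)}.
  apply: (@choice _ _ P) => n; rewrite /P /hausdorff_pre.
  set S := (X in ereal_inf X); move infS : (ereal_inf S) => iS.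
  case: iS infS => [r Sr|Soo|Soo].
  - have en1 : (0 < e%:num / (2 ^ n.+1)%:R)%R by [].
    have /(lb_ereal_inf_adherent en1) : ereal_inf S \is a fin_num by rewrite Sr.
    move=> [x [B ? <-] xS].
    by exists B; split => //; rewrite -Sr; exact/ltW.
  - by have := Aoo n; rewrite /hausdorff_pre Soo.
  - suff : lbound S 0 by move/le_ereal_inf_tmp; rewrite Soo.
    move=> /= _ [B ? <-]; apply: nneseries_ge0 => *; exact: area_gauge_ge0.
have muG_ge0 x : 0 <= (area_gauge \o uncurry G) x by exact: area_gauge_ge0.
apply: (@le_trans _ _ (\esum_(i in setT) (area_gauge \o uncurry G) i)).
  rewrite /hausdorff_pre; apply: ereal_inf_lbound => /=.
  have /card_esym/ppcard_eqP[f] := card_nat2.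
  exists (uncurry G \o f).
    split => [|i]; last by move: (PG (f i).1) => -[[_ +] _] => /(_ (f i).2);
      rewrite /= /uncurry; case: (f i).
    apply: (@subset_trans _  (\bigcup_n \bigcup_k G n k)) => [t [i _]|].
      by move=> /((PG i).1.1) -[j _ ?]; exists i => //; exists j.
    move=> t [i _ [j _ Bijt]]; exists (f^-1%FUN (i, j)) => //=.
    by rewrite invK ?inE.
  rewrite -(esum_pred_image (area_gauge \o uncurry G) _ xpredT)
    ?[fun=> _]set_true//.
  by rewrite image_eq.
rewrite (_ : esum _ _ =
    \sum_(i <oo) \sum_(j <oo) area_gauge (G i j)); last first.
  pose J : nat -> set (nat * nat) := fun i => [set (i, j) | j in setT].
  rewrite (_ : setT = \bigcup_k J k); last first.
    by rewrite predeqE => -[a b]; split => // _; exists a => //; exists b.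
  rewrite esum_bigcupT /=; last 2 first.
    - apply/trivIsetP => i j _ _ ij.
      rewrite predeqE => -[n m] /=; split => //= -[] [_] _ [<-{n} _].
      by move=> [m' _] [] /esym/eqP; rewrite (negbTE ij).
    - by move=> /= [n m]; exact: area_gauge_ge0.
  rewrite -(image_id [set: nat]) -fun_true esum_pred_image//; last first.
    by move=> n _; apply: esum_ge0 => ? _; exact: area_gauge_ge0.
  apply: eq_eseriesr => /= j _.
  rewrite -(esum_pred_image (area_gauge \o uncurry G) (pair j) predT)//=;
    last 2 first.
  - by move=> n _; exact: area_gauge_ge0.
  - by move=> ? ? _ _; exact: (@can_inj _ _ _ snd).
  by congr (esum _ _); apply/seteqP; split => -[a b] [i _ <-]; exists i.
apply: lee_lim.
- apply: is_cvg_nneseries => n *.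
  by apply: nneseries_ge0 => m *; exact: (muG_ge0 (n, m)).
- by apply: is_cvg_nneseries => n *; apply: adde_ge0 => //;
    exact: hausdorff_pre_ge0.
- by near=> n; apply: lee_sum => i _; exact: (PG i).2.
Unshelve. all: by end_near. Qed.

Lemma hausdorff2_set0 : hausdorff2 set0 = 0.
Proof.
apply/eqP; rewrite eq_le; apply/andP; split.
  apply: ge_ereal_sup => _ [delta d0 <-]; apply: ereal_inf_lbound.
  exists (fun=> set0).
    by split => // k; rewrite ediam0 lee_fin ltW.
  by rewrite eseries0// => *; exact: area_gauge0.
apply: (le_trans (hausdorff_pre_ge0 1 set0)).
by apply: ereal_sup_ubound; exists 1%R => //=.
Qed.

Lemma hausdorff2_ge0 A : 0 <= hausdorff2 A.
Proof.
apply: (le_trans (hausdorff_pre_ge0 1 A)).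
by apply: ereal_sup_ubound; exists 1%R => //=.
Qed.

Lemma le_hausdorff2 : {homo hausdorff2 : A B / A `<=` B >-> A <= B}.
Proof.
move=> A B AB; apply: ge_ereal_sup => _ [delta d0 <-].
apply: (le_trans (le_hausdorff_pre delta AB)).
by apply: ereal_sup_ubound; exists delta.
Qed.

Lemma hausdorff2_sigma_subadditive : sigma_subadditive hausdorff2.
Proof.
move=> F; apply: ge_ereal_sup => _ [delta d0 <-].
apply: (le_trans (hausdorff_pre_sigma_subadditive delta F)).
apply: lee_nneseries => [i _ _|i _]; first exact: hausdorff_pre_ge0.
by apply: ereal_sup_ubound; exists delta.
Qed.

HB.instance Definition _ := isOuterMeasure.Build R 'cV[R]_3 hausdorff2
  hausdorff2_set0 hausdorff2_ge0 le_hausdorff2 hausdorff2_sigma_subadditive.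

End hausdorff.

Definition cara_measure (R : realType) (T : pointedType)
    (mu : {outer_measure set T -> \bar R}) :
  {measure set (caratheodory_type mu) -> \bar R} :=
  (mu : set (caratheodory_type mu) -> \bar R).

(* R^3 with the sigma-algebra of Caratheodory H^2-measurable sets, which
   contains the Borel sets (H^2 is a metric outer measure). *)
Notation H2space R := (caratheodory_type (@hausdorff2 R)).

Definition H2 {R : realType} : {measure set (H2space R) -> \bar R} :=
  cara_measure (@hausdorff2 R).

Section calculus.
Context {R : realType}.
Implicit Types (Om : set 'cV[R]_3) (u g : 'cV[R]_3 -> 'cV[R]_3).

Definition basis (j : 'I_3) : 'cV[R]_3 := delta_mx j 0.

(* Classical gradient, (grad g x) i j = d g_i / d x_j (x). *)
Definition grad g (x : 'cV[R]_3) : 'M[R]_3 :=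
  \matrix_(i, j) ('D_(basis j) g x) i 0.

Definition C1_on Om g : Prop :=
  forall x, Om x -> differentiable g x /\ {for x, continuous (grad g)}.

Definition C1_diffeo Om g : Prop :=
  exists h : 'cV[R]_3 -> 'cV[R]_3,
    [/\ open (g @` Om), C1_on Om g, C1_on (g @` Om) h &
        forall x, Om x -> h (g x) = x].

Fixpoint Ck (k : nat) (f : 'cV[R]_3 -> R) : Prop :=
  if k is k'.+1 then
    forall j, (forall x, derivable f x (basis j)) /\ Ck k' ('D_(basis j) f)
  else continuous f.

Definition smooth (f : 'cV[R]_3 -> R) : Prop := forall k, Ck k f.

Definition spt (f : 'cV[R]_3 -> R) : set 'cV[R]_3 := closure [set x | f x != 0].

Definition test_fun Om (phi : 'cV[R]_3 -> R) : Prop :=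
  [/\ smooth phi, compact (spt phi) & spt phi `<=` Om].

Definition C0_fun Om (phi : 'cV[R]_3 -> R) : Prop :=
  (forall x, Om x -> {for x, continuous phi}) /\
  forall e, 0 < e -> exists K : set 'cV[R]_3,
    [/\ compact K, K `<=` Om & forall x, Om x -> ~ K x -> `|phi x| < e].

End calculus.

Section SBV.
Context {R : realType}.
Implicit Types (Om D : set 'cV[R]_3) (u v g : 'cV[R]_3 -> 'cV[R]_3).
Implicit Types (F G : 'cV[R]_3 -> 'M[R]_3) (x z nu : 'cV[R]_3).

Definition L1 m n Om (f : 'cV[R]_3 -> 'M[R]_(m, n)) : Prop :=
  forall i j, leb3.-integrable Om (fun x => (f x i j)%:E).

Definition mean_osc u D z : R :=
  (\int[leb3]_(y in D) enorm (u y - z)) / fine (leb3 D).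

Definition approx_limit u (D : R -> set 'cV[R]_3) z : Prop :=
  mean_osc u (D r) z @[r --> 0^'+] --> 0.

(* S_u *)
Definition disc_set Om u : set 'cV[R]_3 :=
  [set x | Om x /\ ~ exists z, approx_limit u (eball x) z].

Definition half_ball x nu (r : R) : set 'cV[R]_3 :=
  eball x r `&` [set y | 0 < dot (y - x) nu].

(* u has distinct one-sided approximate limits up and um at x, with respect to
   the direction nu. *)
Definition jump_triple u x up um nu : Prop :=
  [/\ up != um, enorm nu = 1, approx_limit u (half_ball x nu) up &
      approx_limit u (half_ball x (- nu)) um].

(* [u] (x) nu_u.  The triple (up, um, nu) is unique up to the exchange with
   (um, up, - nu), which leaves the tensor unchanged; for a BV function,
   H^2-almost every point of S_u is a jump point (Federer-Vol'pert). *)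
Definition jump_tens u x : 'M[R]_3 :=
  xget 0 [set J | exists up um nu,
    jump_triple u x up um nu /\ J = tens (up - um) nu].

Definition pair_ac Om F (phi : 'cV[R]_3 -> R) i j : R :=
  \int[leb3]_(x in Om) (phi x * F x i j).

(* Integral of phi against D^s u = [u] (x) nu_u H^2 |_ S_u. *)
Definition pair_sing Om u (phi : 'cV[R]_3 -> R) i j : R :=
  \int[H2]_(x in (disc_set Om u : set (H2space R))) (phi x * jump_tens u x i j).

(* The distributional gradient of u is F L^3 + [u] (x) nu_u H^2 |_ S_u: it is a
   finite measure with absolutely continuous part F and no Cantor part. *)
Definition SBV_gradient Om u F : Prop :=
  [/\ L1 Om F,
      measurable (disc_set Om u : set (H2space R)),
      forall i j, H2.-integrable (disc_set Om u : set (H2space R))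
                    (fun x => (jump_tens u x i j)%:E) &
      forall phi, test_fun Om phi -> forall i j,
        \int[leb3]_(x in Om) (u x i 0 * 'D_(basis j) phi x) =
        - (pair_ac Om F phi i j + pair_sing Om u phi i j)].

Definition SBV Om u : Prop := L1 Om u /\ exists F, SBV_gradient Om u F.

(* A representative of the density of the absolutely continuous part of D u,
   which is unique almost everywhere. *)
Definition sbv_grad Om u : 'cV[R]_3 -> 'M[R]_3 :=
  xget (fun=> 0) [set F | SBV_gradient Om u F].

Definition inv_struct_def Om g G : Prop :=
  [/\ SBV Om g /\ L1 Om G,
      [/\ C1_diffeo Om g, [lipschitz grad g x | x in Om] &
          [lipschitz invmx (grad g x) | x in Om]],
      {within closure Om, continuous G} /\
        (forall x, closure Om x -> G x \in unitmx) &
      forall x, Om x -> \det (grad g x) = \det (G x)].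

Definition Kmx (A B : 'M[R]_3) : 'M[R]_3 := invmx A *m B.
Definition Mmx (A B : 'M[R]_3) : 'M[R]_3 := 1%:M - Kmx A B.

Definition K_pair g G x : 'M[R]_3 := Kmx (grad g x) (G x).
Definition M_pair g G x : 'M[R]_3 := Mmx (grad g x) (G x).

Definition crystallographic N (s m : 'I_N -> 'cV[R]_3) Om g G : Prop :=
  inv_struct_def Om g G /\
  exists gamma : 'I_N -> 'cV[R]_3 -> R, forall x, Om x ->
    1%:M - K_pair g G x = \sum_a gamma a x *: tens (s a) (m a).

Definition Ad Om g G (u : nat -> 'cV[R]_3 -> 'cV[R]_3) : Prop :=
  [/\ forall n, SBV Om (u n),
      \int[leb3]_(x in Om) enorm (u n x - g x) @[n --> \oo] --> 0,
      forall phi, C0_fun Om phi -> forall i j,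
        pair_ac Om (sbv_grad Om (u n)) phi i j @[n --> \oo] -->
        pair_ac Om G phi i j &
      forall phi, C0_fun Om phi -> forall i j,
        pair_sing Om (u n) phi i j @[n --> \oo] -->
        pair_ac Om (fun x => grad g x - G x) phi i j + pair_sing Om g phi i j].

End SBV.

Section energies.
Context {R : realType}.
Implicit Types (Om : set 'cV[R]_3) (u g : 'cV[R]_3 -> 'cV[R]_3).
Implicit Types (alpha : 'cV[R]_3 -> R) (Psi : 'M[R]_3 -> R) (r : R).

Definition sublinear_growth Psi : Prop :=
  forall e, 0 < e -> exists c, forall X, c < `|X| -> `|Psi X / `|X| | < e.

Definition slip_periodic N (s m : 'I_N -> 'cV[R]_3) (p : 'I_N -> R) Psi :=
  forall a b (xi : R) (t : 'cV[R]_3), dot t (m a) = 0 ->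
    Psi (tens (t + p a *: s a) (m a) + xi *: tens (cross (m a) (m b)) (m b)) =
    Psi (tens t (m a) + xi *: tens (cross (m a) (m b)) (m b)).

Definition mollifier alpha r (x : 'cV[R]_3) : R := r ^- 3 * alpha (r^-1 *: x).

Definition conv_ac Om (F : 'cV[R]_3 -> 'M[R]_3) alpha x : 'M[R]_3 :=
  \matrix_(i, j) pair_ac Om F (fun y => alpha (x - y)) i j.

Definition conv_sing Om u alpha x : 'M[R]_3 :=
  \matrix_(i, j) pair_sing Om u (fun y => alpha (x - y)) i j.

Definition Psi_of Psi g x (L : 'M[R]_3) : R := Psi (invmx (grad g x) *m L).

Definition energy Om alpha Psi g r u : R :=
  \int[leb3]_(x in inner Om r)
    Psi_of Psi g x (conv_sing Om u (mollifier alpha r) x).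

(* lim_n E (u_n) for a given sequence; it does not depend on the admissible
   sequence. *)
Definition upscaled_energy Om alpha Psi g
    (u : nat -> 'cV[R]_3 -> 'cV[R]_3) r : R :=
  limn (fun n => energy Om alpha Psi g r (u n)).

Definition rotation (Q : 'M[R]_3) : Prop := Q^T *m Q = 1%:M /\ \det Q = 1.

End energies.

(* Main.v *)
(* For x in Om_r the kernel y |-> alpha_r (x - y) has compact support in Om, so
   the weak-* convergence of D^s u_n gives D^s u_n * alpha_r -> (grad g - G) * alpha_r
   pointwise on Om_r (D^s g = 0 as g is continuous).  By Banach-Steinhaus these
   convolutions are bounded uniformly in n and x, hence so are the densities, Psi
   being Lipschitz and (grad g)^-1 bounded, and the energies converge by dominated
   convergence.  The limit r -> 0 is dominated convergence again: mollifications of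
   the bounded continuous field grad g - G converge to it at every point of Om, and
   every point of Om eventually lies in Om_r.  Pairing continuous functions with the
   jump measures presupposes that Borel sets are Caratheodory measurable for the
   Hausdorff measure, which is proved by Caratheodory's criterion on half-spaces. *)

Require Import Defs.
From mathcomp Require Import all_boot all_order all_algebra.
From mathcomp Require Import all_classical all_reals all_analysis.
From mathcomp Require Import measurable_realfun ring lra.
Set Implicit Arguments.
Unset Strict Implicit.
Unset Printing Implicit Defensive.
Import Order.TTheory GRing.Theory Num.Theory.
Import numFieldTopology.Exports numFieldNormedType.Exports.
Local Open Scope classical_set_scope.
Local Open Scope ring_scope.

(** * Dominated convergence and uniform boundedness *)

(** The obstacle is uniformity in [n]. Each singular part D^s u_n has finite mass, but [Ad] states
    no common bound on these masses: it only gives convergence of the pairings with one test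
    function at a time, so a bound has to be extracted from convergence. C_0(Om) is not set up as a
    Banach space for this. Only the kernels y |-> alpha_r (x - y) with x in Om_r matter, and the
    test functions used are the series sum_k c_k alpha_r (x_k - y) with |c_k| <= 4^-k. Such a series
    converges uniformly and its partial sums have compact support in Om, so it lies in C_0(Om) and
    its pairings are bounded in n; the gliding hump turns boundedness along every such series into
    one bound over all n and x. The limit r -> 0 is easier, because grad g - G is bounded and the
    L^1 norm of alpha_r does not depend on r. As alpha may change sign, that norm, and not the mass
    1, enters the bounds. Pairings and convolutions are studied for an abstract measure, since they
    occur with both Lebesgue and Hausdorff measure. *)

Section integration.
Context d (T : measurableType d) (R : realType) (mu : {measure set T -> \bar R}).
Implicit Types (D : set T) (f g h : T -> R).

Lemma dominated_integrable D f g : measurable D -> measurable_fun D f ->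
  mu.-integrable D (EFin \o g) -> (forall x, D x -> `|f x| <= `|g x|) ->
  mu.-integrable D (EFin \o f).
Proof.
move=> mD mf ig fg; apply: le_integrable ig => //; first exact/measurable_EFinP.
Qed.

Lemma Rdominated_convergence D (f : nat -> T -> R) h g : measurable D ->
  (forall n, measurable_fun D (f n)) ->
  (forall x, D x -> f n x @[n --> \oo] --> h x) ->
  mu.-integrable D (EFin \o g) -> (forall n x, D x -> `|f n x| <= g x) ->
  mu.-integrable D (EFin \o h) /\
  \int[mu]_(x in D) f n x @[n --> \oo] --> \int[mu]_(x in D) h x.
Proof.
move=> mD mf fh ig fg.
have mh : measurable_fun D h.
  exact: (measurable_fun_cvg mf fh).
have [] := @dominated_convergence _ T R mu D mD (fun n => EFin \o f n)
    (EFin \o h) (EFin \o g).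
- by move=> n; exact/measurable_EFinP.
- exact/measurable_EFinP.
- by apply: aeW => x Dx; apply: cvg_EFin; [exact: nearW|exact: fh].
- exact: ig.
- by apply: aeW => x n Dx /=; rewrite lee_fin fg.
move=> ih _ cfh; split => //; apply: fine_cvg.
by rewrite fineK//; exact: integrable_fin_num.
Qed.

Lemma le_Rintegral_bound D f g (C : R) : measurable D -> measurable_fun D f ->
  mu.-integrable D (EFin \o g) -> 0 <= C ->
  (forall x, D x -> `|f x| <= C * `|g x|) ->
  mu.-integrable D (EFin \o f) /\
  `|\int[mu]_(x in D) f x| <= C * \int[mu]_(x in D) `|g x|.
Proof.
move=> mD mf ig C0 fg.
have iag : mu.-integrable D (EFin \o (fun x => `|g x|)).
  exact: (integrable_abse ig).
have iCg : mu.-integrable D (EFin \o (fun x => C * `|g x|)).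
  by have := integrableZl mD C iag; apply: eq_integrable => // x _ /=; rewrite EFinM.
have if_ : mu.-integrable D (EFin \o f).
  apply: dominated_integrable iCg _ => // x Dx.
  by rewrite (ger0_norm (_ : 0 <= C * `|g x|)) ?mulr_ge0// fg.
split => //; rewrite -RintegralZl//.
apply: le_trans (le_normr_Rintegral _ _) _ => //.
by apply: le_Rintegral => //; exact: (integrable_abse if_).
Qed.

End integration.

(** * Uniform boundedness by a gliding hump *)

Section gliding_hump.
Context (R : realType) (Y : Type) (a : nat -> Y -> R).

(** The next coefficient, given the earlier ones [l]: its sign makes the new term agree in sign with
    the partial sum [p], so that nothing cancels. *)
Let step (n : nat -> nat) (y : nat -> Y) k (l : seq R) : R :=
  let p := \sum_(j < k) nth 0 l j * a (n k) (y j) in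
  if (0 <= p) == (0 <= a (n k) (y k)) then 4^-1 ^+ k else - 4^-1 ^+ k.

Let history n y := fix hist k : seq R :=
  if k is k'.+1 then rcons (hist k') (step n y k' (hist k')) else [::].

(** The choice of signs replaces the classical control of the earlier terms: since the last term has
    the sign of the sum before it, the absolute values add up, and the last term alone is a lower
    bound. *)
Lemma hump_signs (n : nat -> nat) (y : nat -> Y) :
  exists c : nat -> R, (forall k, `|c k| = 4^-1 ^+ k) /\
  forall k, 4^-1 ^+ k * `|a (n k) (y k)| <=
            `|\sum_(j < k.+1) c j * a (n k) (y j)|.
Proof.
pose l := history n y; pose c k := step n y k (l k).
have szl k : size (l k) = k by elim: k => //= k IH; rewrite size_rcons IH.
have lE k j : (j < k)%N -> nth 0 (l k) j = c j.
  elim: k => // k IH; rewrite ltnS leq_eqVlt => /predU1P[->|jk] /=.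
    by rewrite nth_rcons szl ltnn eqxx.
  by rewrite nth_rcons szl jk IH.
exists c; split => [k|k].
  by rewrite /c /step; case: ifP => _; rewrite ?normrN ger0_norm ?exprn_ge0 ?invr_ge0.
rewrite big_ord_recr/=; set p := \sum_(_ < _) _.
have -> : c k = if (0 <= p) == (0 <= a (n k) (y k)) then 4^-1 ^+ k else - 4^-1 ^+ k.
  rewrite /c /step (_ : \sum_(_ < _) _ = p)//.
  by apply: eq_bigr => j _; rewrite lE.
move: (a _ (y k)) => b; have : (0 : R) <= 4^-1 ^+ k by rewrite exprn_ge0 ?invr_ge0.
move: (4^-1 ^+ k) => q q0.
rewrite -{1}(ger0_norm q0) -normrM.
case: (leP 0 p) => p0; case: (leP 0 b) => b0 /=.
- by rewrite [leRHS]ger0_norm ?addr_ge0 ?mulr_ge0// ger0_norm ?mulr_ge0//; lra.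
- have : q * b <= 0 by rewrite mulr_ge0_le0// ltW.
  by move=> ?; rewrite mulNr ler0_norm// ger0_norm; lra.
- have : 0 <= q * b by rewrite mulr_ge0.
  by move=> ?; rewrite mulNr ger0_norm// ler0_norm; lra.
- have : q * b <= 0 by rewrite mulr_ge0_le0// ltW.
  by move=> ?; rewrite ler0_norm// ler0_norm; lra.
Qed.

(* The sequence [c] plays the role of an element of l^1: this is the
   Banach-Steinhaus theorem for the functionals [c |-> \sum_k c k * a n (y k)],
   proved by a gliding hump instead of the Baire category theorem. *)
Lemma uniform_boundedness (A : nat -> R) :
  (forall n y, `|a n y| <= A n) ->
  (forall (c : nat -> R) (y : nat -> Y), (forall k, `|c k| <= 4^-1 ^+ k) ->
    exists M, forall n, exists l : R, `|l| <= M /\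
      \sum_(j < k) c j * a n (y j) @[k --> \oo] --> l) ->
  exists M, forall n y, `|a n y| <= M.
Proof.
move=> aA bnd; apply: contrapT => /forallNP nM.
(* Without a bound some [a n] exceeds 8^k at a point. As [a n] is bounded by [A n], the point can be
   moved to one where at least half of the supremum is reached; this factor 2 will control the terms
   after the k-th. *)
have big k : exists ny : nat * Y,
    8 ^+ k <= `|a ny.1 ny.2| /\ forall y, `|a ny.1 y| <= 2 * `|a ny.1 ny.2|.
  have /existsNP[n /existsNP[y0 /negP]] := nM (8 ^+ k).
  rewrite -ltNge => any0.
  pose S := [set `|a n y| | y in [set: Y]].
  have supS : has_sup S.
    by split; [exists `|a n y0|; exists y0|exists (A n) => _ [y _ <-]].
  have leS y : `|a n y| <= sup S by apply: ub_le_sup; [case: supS|exists y].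
  have k8 : (0 : R) < 8 ^+ k by rewrite exprn_gt0.
  have [h|h] := leP (sup S / 2) `|a n y0|.
    by exists (n, y0) => /=; split; [exact: ltW|move=> y; have := leS y; lra].
  have S0 : 0 < sup S / 2 by lra.
  have [_ [y _ <-]] := sup_adherent S0 supS => hy.
  exists (n, y) => /=; split; first by lra.
  by move=> z; have := leS z; lra.
have [ny nyP] := choice big.
pose n k := (ny k).1; pose y k := (ny k).2.
have [c [cE cP]] := hump_signs n y.
have [M hM] : exists M, forall n, exists l : R, `|l| <= M /\
    \sum_(j < k) c j * a n (y j) @[k --> \oo] --> l.
  by apply: bnd => k; rewrite cE.
(* The terms after the k-th amount to at most 2 |q| sum_(j > k) 4^-j = (2/3) 4^-k |q|, so a third of
   the k-th term survives; with |q| >= 8^k this is at least 2^k / 3. *)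
have lower k : 2 ^+ k / 3 <= M.
  have [l [lM cvl]] := hM (n k).
  apply: le_trans lM; set q := a (n k) (y k).
  have q8 : 8 ^+ k <= `|q| := (nyP k).1.
  have q2 z : `|a (n k) z| <= 2 * `|q| := (nyP k).2 z.
  have tail i : `|\sum_(j < k.+1 + i) c j * a (n k) (y j)| >=
      4^-1 ^+ k * `|q| - 2 * `|q| * (4^-1 ^+ k / 3 * (1 - 4^-1 ^+ i)).
    elim: i => [|i IH].
      by rewrite addn0 expr0 subrr !mulr0 subr0; exact: cP.
    rewrite addnS big_ord_recr/= ; set s := \sum_(_ < _) _ in IH *.
    have : `|s| - `|c (k.+1 + i)%N * a (n k) (y (k.+1 + i)%N)| <=
        `|s + c (k.+1 + i)%N * a (n k) (y (k.+1 + i)%N)|.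
      by rewrite -[X in _ - `|X|]opprK normrN -{2}[c _ * _]opprK lerB_dist.
    have : `|c (k.+1 + i)%N * a (n k) (y (k.+1 + i)%N)| <=
        4^-1 ^+ (k.+1 + i) * (2 * `|q|).
      by rewrite normrM cE ler_wpM2l// exprn_ge0 ?invr_ge0.
    move: IH; rewrite addSn !exprS exprD.
    set u := `|_ + _|; set v := `|c _ * _|; move: (`|q|) (4^-1 ^+ k) (4^-1 ^+ i).
    by move=> ? ? ? ? ? ?; nra.
  have low i : 4^-1 ^+ k * `|q| / 3 <= `|\sum_(j < k.+1 + i) c j * a (n k) (y j)|.
    apply: le_trans (tail i).
    have : (0 : R) <= 4^-1 ^+ i by rewrite exprn_ge0 ?invr_ge0.
    have : (0 : R) <= 4^-1 ^+ k by rewrite exprn_ge0 ?invr_ge0.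
    have := normr_ge0 q.
    move: (`|q|) (4^-1 ^+ k) (4^-1 ^+ i) => u v w u0 v0 w0.
    have := mulr_ge0 (mulr_ge0 u0 v0) w0; nra.
  apply: (@le_trans _ _ (4^-1 ^+ k * `|q| / 3)).
    rewrite ler_wpM2r ?invr_ge0//.
    rewrite (_ : 2 ^+ k = 4^-1 ^+ k * 8 ^+ k); last first.
      by rewrite -exprMn; congr (_ ^+ k); field.
    by rewrite ler_wpM2l// exprn_ge0 ?invr_ge0.
  apply: (cvgr_to_ge (cvg_norm cvl)).
  near=> N; have kN : (k.+1 <= N)%N by near: N; exact: nbhs_infty_ge.
  by rewrite -(subnKC kN).
have [k Mk] : exists k : nat, M < k%:R / 3.
  by exists (Num.truncn (M * 3)).+1; have := truncnS_gt (M * 3); lra.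
have : (k%:R : R) <= 2 ^+ k by rewrite -natrX ler_nat ltnW// ltn_expl.
by have := lower k; lra.
Unshelve. all: by end_near. Qed.

End gliding_hump.

(** * Euclidean norm and Borel sets *)

Section euclidean_norm.
Context {R : realType}.
Implicit Types x y v w : 'cV[R]_3.

Lemma dot3E v w : dot v w = v 0 0 * w 0 0 + v 1 0 * w 1 0 + v (1 + 1) 0 * w (1 + 1) 0.
Proof.
rewrite /dot !big_ord_recl big_ord0 addr0 addrA.
by congr (_ + _ * _ + _ * _); congr (_ _ 0); exact/val_inj.
Qed.

Lemma dotvv_ge0 v : 0 <= dot v v.
Proof. by apply: sumr_ge0 => i _; rewrite -expr2 sqr_ge0. Qed.

Lemma enorm_ge0 v : 0 <= enorm v. Proof. exact: sqrtr_ge0. Qed.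

Lemma enorm_sqr v : enorm v ^+ 2 = dot v v.
Proof. by rewrite sqr_sqrtr ?dotvv_ge0. Qed.

Lemma enormZ a v : enorm (a *: v) = `|a| * enorm v.
Proof.
rewrite /enorm (_ : dot _ _ = a ^+ 2 * dot v v).
  by rewrite sqrtrM ?sqr_ge0// sqrtr_sqr.
by rewrite !dot3E !mxE; ring.
Qed.

Lemma enormN v : enorm (- v) = enorm v.
Proof. by rewrite -scaleN1r enormZ normrN1 mul1r. Qed.

Lemma enormB v w : enorm (v - w) = enorm (w - v).
Proof. by rewrite -opprB enormN. Qed.

Lemma enorm_triangle v w : enorm (v + w) <= enorm v + enorm w.
Proof.
rewrite -(ler_pXn2r (_ : (0 < 2)%N)) ?nnegrE ?addr_ge0 ?enorm_ge0//.
rewrite sqrrD !enorm_sqr.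
have -> : dot (v + w) (v + w) = dot v v + dot v w *+ 2 + dot w w.
  by rewrite !dot3E !mxE mulr2n; ring.
rewrite lerD2r lerD2l lerMn2r /=.
have [/ltW vw|vw] := ltP (dot v w) 0.
  by rewrite (le_trans vw)// mulr_ge0 ?enorm_ge0.
rewrite -(ler_pXn2r (_ : (0 < 2)%N)) ?nnegrE ?mulr_ge0 ?enorm_ge0//.
rewrite exprMn !enorm_sqr !dot3E.
move: (v 0 0) (v 1 0) (v (1 + 1) 0) (w 0 0) (w 1 0) (w (1 + 1) 0) => a b c a' b' c'.
(* Lagrange's identity: the three squares add up to the defect in the Cauchy-Schwarz inequality. *)
have := sqr_ge0 (a * b' - b * a'); have := sqr_ge0 (a * c' - c * a').
by have := sqr_ge0 (b * c' - c * b'); nra.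
Qed.

Lemma coord_le_enorm v i : `|v i 0| <= enorm v.
Proof.
rewrite -sqrtr_sqr ler_sqrt ?dotvv_ge0// /dot (bigD1 i)//= -expr2 lerDl.
by apply: sumr_ge0 => j _; rewrite -expr2 sqr_ge0.
Qed.

Lemma entry_le_norm m n (A : 'M[R]_(m, n)) i j : `|A i j| <= `|A|.
Proof.
by rewrite [leRHS]/Num.norm /= mx_normrE; apply/bigmax_geP; right => /=; exists (i, j).
Qed.

Lemma norm_le_entry m n (A : 'M[R]_(m, n)) c :
  0 <= c -> (forall i j, `|A i j| <= c) -> `|A| <= c.
Proof.
move=> c0 Ac; rewrite [leLHS]/Num.norm /= mx_normrE; apply/bigmax_leP; split => //=.
Qed.

Lemma norm_le_enorm v : `|v| <= enorm v.
Proof. apply: norm_le_entry => [|i j]; first exact: enorm_ge0.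
by rewrite (ord1 j); exact: coord_le_enorm. Qed.

(** The factor 2 stands for the sharp constant sqrt 3. *)
Lemma enorm_le_norm v : enorm v <= 2 * `|v|.
Proof.
rewrite -(ler_pXn2r (_ : (0 < 2)%N)) ?nnegrE ?mulr_ge0 ?enorm_ge0//.
have h i : v i 0 ^+ 2 <= `|v| ^+ 2.
  by rewrite -real_normK ?num_real// ler_pXn2r ?nnegrE ?entry_le_norm.
rewrite enorm_sqr dot3E exprMn; have := h 0; have := h 1; have := h (1 + 1).
by have := sqr_ge0 `|v|; nra.
Qed.

Lemma eball_sub_ball x (r : R) : 0 < r -> eball x r `<=` ball x r.
Proof.
move=> r0 y /=; rewrite -ball_normE /= => h.
by rewrite distrC; apply: le_lt_trans h; exact: norm_le_enorm.
Qed.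

Lemma ball_sub_eball x (r : R) : ball x (r / 2) `<=` eball x r.
Proof.
move=> y; rewrite -ball_normE /= /eball /= distrC => h.
by apply: le_lt_trans (enorm_le_norm _) _; rewrite mulrC -ltr_pdivlMr.
Qed.

Lemma nbhs_eball x (r : R) : 0 < r -> nbhs x (eball x r).
Proof.
by move=> r0; apply/nbhs_ballP; exists (r / 2); [exact: divr_gt0|exact: ball_sub_eball].
Qed.

Lemma nbhs_eballP x (A : set 'cV[R]_3) :
  nbhs x A <-> exists2 r, 0 < r & eball x r `<=` A.
Proof.
split=> [/nbhs_ballP[r /= r0 rA]|[r r0 rA]].
  by exists r => //; apply: subset_trans rA; exact: eball_sub_ball.
exact: filterS rA (nbhs_eball _ r0).
Qed.

Lemma enorm_dist v w : `|enorm v - enorm w| <= enorm (v - w).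
Proof.
have := enorm_triangle (v - w) w; have := enorm_triangle (w - v) v.
rewrite !subrK (enormB w v) => ? ?; rewrite ler_norml; apply/andP; split; lra.
Qed.

Lemma enorm_continuous : continuous (@enorm R).
Proof.
move=> x; have FF : Filter (nbhs x) by exact: nbhs_filter.
apply/cvgrPdist_lt => e e0.
apply: filterS (nbhs_eball x e0) => y; rewrite /eball /= => h.
by apply: (le_lt_trans (enorm_dist _ _)); rewrite enormB.
Qed.

Lemma open_eball x (r : R) : open (eball x r).
Proof.
rewrite openE => y yr; apply/nbhs_eballP; exists (r - enorm (y - x)).
  by rewrite subr_gt0.
move=> z; rewrite /eball /= ltrBrDr => h; apply: le_lt_trans h.
by rewrite -[leLHS](_ : enorm ((z - y) + (y - x)) = _) ?enorm_triangle// addrA subrK.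
Qed.

End euclidean_norm.

Section borel.
Context {R : realType}.

Lemma measurable_coord n (i : 'I_n) :
  measurable_fun [set: 'cV[R]_n] (fun x : 'cV[R]_n => x i 0).
Proof.
move=> _ B mB; rewrite setTI; apply: sub_sigma_algebra.
by rewrite -bigcup_seq; exists i => /=; [rewrite mem_index_enum|exists B; rewrite ?setTI].
Qed.

Lemma measurable_ball_colvec n (x : 'cV[R]_n) (r : R) : measurable (ball x r).
Proof.
have [r0|r0] := leP r 0.
  by rewrite (_ : ball x r = set0)//; apply/seteqP; split => // y;
    rewrite -ball_normE /= => /(le_lt_trans (normr_ge0 _)); rewrite ltNge r0.
rewrite (_ : ball x r = \bigcap_(i in [set: 'I_n]) 
    ((fun y : 'cV[R]_n => y i 0) @^-1` ball (x i 0) r)).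
  apply: fin_bigcap_measurable => // i _; rewrite -[X in measurable X]setTI.
  by apply: measurable_coord => //; exact: measurable_ball.
apply/seteqP; split=> y.
  move=> xy i _; rewrite /= -ball_normE /=.
  have -> : x i 0 - y i 0 = (x - y) i 0 by rewrite !mxE.
  by apply: le_lt_trans (entry_le_norm _ _ _) _; move: xy; rewrite -ball_normE.
move=> xy; split => // i j; rewrite (ord1 j); exact: xy.
Qed.

(** Second countability: an open set is the union of the countably many balls of rational centre and
    radius 1 / (k + 1) that it contains. This ties the topology to the sigma-algebra generated by
    the coordinates. *)
Lemma open_measurable_colvec n (U : set 'cV[R]_n) : open U -> measurable U.
Proof.
move=> oU.
pose q (k : 'cV[rat]_n * nat) : set 'cV[R]_n := ball (map_mx (ratr : rat -> R) k.1) k.2.+1%:R^-1.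
rewrite (_ : U = \bigcup_(k in [set k | q k `<=` U]) q k).
  rewrite bigcup_mkcond; apply: countable_bigcupT_measurable; first exact: countableP.
  by move=> k; case: ifPn => _ //; exact: measurable_ball_colvec.
apply/seteqP; split=> x; last by case => k /= kU /kU.
move=> Ux; move: oU; rewrite openE => /(_ _ Ux) /nbhs_ballP[e /= e0 eU].
have [k ke] : exists k : nat, k.+1%:R^-1 < e / 2.
  exists (Num.truncn (e / 2)^-1); rewrite -[ltRHS]invrK ltf_pV2 ?posrE ?invr_gt0 ?divr_gt0//.
  exact: truncnS_gt.
have k0 : 0 < k.+1%:R^-1 :> R by rewrite invr_gt0.
have /choice[c cP] : forall i : 'I_n, exists c : rat,
    ratr c \in `]x i 0 - k.+1%:R^-1, x i 0 + k.+1%:R^-1[.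
  move=> i; have : x i 0 - k.+1%:R^-1 < x i 0 + k.+1%:R^-1.
    by move: (k.+1%:R^-1) k0 => h; lra.
  by move=> /rat_in_itvoo[c]; exists c.
have xq : q (\col_i c i, k) x.
  split => // i j; rewrite (ord1 j) !mxE -ball_normE /=.
  have := cP i; rewrite in_itv/= ltr_norml; move: (k.+1%:R^-1) (ratr _) => h z.
  by move=> /andP[? ?]; apply/andP; split; lra.
exists (\col_i c i, k) => //= y qy; apply: eU.
move: xq qy; rewrite /q /= -!ball_normE /= => h1 h2.
set z := map_mx _ _ in h1 h2.
have -> : x - y = - (z - x) + (z - y) by rewrite opprB addrA subrK.
apply: le_lt_trans (ler_normD _ _) _; rewrite normrN.
by move: (k.+1%:R^-1) ke h1 h2 => h ke h1 h2; lra.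
Qed.

Lemma open_continuous_measurable_colvec n (D : set 'cV[R]_n) (f : 'cV[R]_n -> R) :
  open D -> (forall x, D x -> {for x, continuous f}) -> measurable_fun D f.
Proof.
move=> oD cf; apply: (measurability _ (RGenOpens.measurableE R)).
move=> _ [_ [a [b ->] <-]]; apply: open_measurable_colvec.
rewrite openE => x [Dx fx]; apply: filterI; first exact: open_nbhs_nbhs.
by apply: cf => //; apply: open_nbhs_nbhs; split => //; exact: interval_open.
Qed.

End borel.

(** * Borel sets are measurable for the Hausdorff measure *)

Section hausdorff_borel.
Context {R : realType}.
Implicit Types A B X : set 'cV[R]_3.
Local Open Scope ereal_scope.

Lemma hausdorff_pre_antitone (d d' : R) A :
  (d <= d')%R -> hausdorff_pre d' A <= hausdorff_pre d A.
Proof.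
move=> dd'; apply: ereal_inf_le_tmp => _ [F [AF dF] <-]; exists F => //.
by split => // k; apply: le_trans (dF k) _; rewrite lee_fin.
Qed.

(** A covering set of diameter at most [d] cannot meet both [A] and [B], so a cover of the union
    splits into covers of the two sets without any set being counted twice. *)
Lemma hausdorff_pre_separated (d e : R) A B : (d < e)%R ->
  (forall a b, A a -> B b -> e <= enorm (a - b))%R ->
  hausdorff_pre d A + hausdorff_pre d B <= hausdorff_pre d (A `|` B).
Proof.
move=> de AB; apply: le_ereal_inf_tmp => _ [F [ABF dF] <-].
pose meet A := fun k => if F k `&` A == set0 then set0 else F k.
have cover A' : A' `<=` A `|` B ->
    hausdorff_pre d A' <= \sum_(k <oo) area_gauge (meet A' k).
  move=> A'AB; apply: ereal_inf_lbound; exists (meet A') => //; split.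
    move=> x A'x; have [k _ Fkx] := ABF _ (A'AB _ A'x); exists k => //.
    rewrite /meet; case: eqP => // F0.
    by have : (F k `&` A') x by []; rewrite F0.
  move=> k; rewrite /meet; case: ifP => _ //.
  by rewrite ediam0; exact: le_trans (ediam_ge0 _) (dF k).
apply: le_trans (leeD (cover A _) (cover B _)) _; [by left|by right|].
rewrite -nneseriesD; try by move=> *; exact: area_gauge_ge0.
apply: lee_nneseries => [k _ _|k _].
  by apply: adde_ge0; exact: area_gauge_ge0.
rewrite /meet; case: eqP => FA; case: eqP => FB;
  rewrite ?area_gauge0 ?add0e ?adde0 ?area_gauge_ge0//.
have /set0P[a [Fa Aa]] := introN eqP FA.
have /set0P[b [Fb Bb]] := introN eqP FB.
have := dF k; rewrite leNgt => /negP[].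
apply: (@lt_le_trans _ _ (enorm (a - b))%:E).
  by rewrite lte_fin; exact: lt_le_trans (AB _ _ Aa Bb).
by apply: ereal_sup_ubound; right; exists (a, b).
Qed.

Lemma hausdorff2_separated (e : R) A B : (0 < e)%R ->
  (forall a b, A a -> B b -> e <= enorm (a - b))%R ->
  hausdorff2 A + hausdorff2 B <= hausdorff2 (A `|` B).
Proof.
move=> e0 AB; have [ABoo|] := eqVneq (hausdorff2 (A `|` B)) +oo.
  by rewrite ABoo leey.
rewrite -ltey => ABoo.
have finH A' : A' `<=` A `|` B -> hausdorff2 A' \is a fin_num.
  move=> A'AB; rewrite ge0_fin_numE ?hausdorff2_ge0//.
  by apply: le_lt_trans ABoo; exact: le_hausdorff2.
have fA : hausdorff2 A \is a fin_num by apply: finH; left.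
have fB : hausdorff2 B \is a fin_num by apply: finH; right.
rewrite -leeBrDr//; apply: ge_ereal_sup => _ [d /= d0 <-].
have fdA : hausdorff_pre d A \is a fin_num.
  rewrite ge0_fin_numE ?hausdorff_pre_ge0//.
  apply: (le_lt_trans _ (_ : hausdorff2 A < +oo)); last by rewrite -ge0_fin_numE ?hausdorff2_ge0.
  by apply: ereal_sup_ubound; exists d.
rewrite leeBrDr// addeC -leeBrDr//; apply: ge_ereal_sup => _ [d' /= d'0 <-].
rewrite leeBrDr// addeC.
(* One scale for both sets: refining [d] and [d'] only increases the premeasures, and being below
   [e] gives separation. *)
pose m : R := Num.min (Num.min d d') (e / 2)%R.
have m0 : (0 < m)%R by rewrite !lt_min d0 d'0 divr_gt0.
have me : (m < e)%R by rewrite gt_min; apply/orP; right; lra.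
apply: le_trans (leeD (hausdorff_pre_antitone A (_ : m <= d)%R)
                      (hausdorff_pre_antitone B (_ : m <= d')%R)) _.
- by rewrite !ge_min lexx.
- by rewrite !ge_min lexx orbT.
apply: le_trans (hausdorff_pre_separated me AB) _.
by apply: ereal_sup_ubound; exists m.
Qed.

(* The half-space is exhausted by [B n]; its layers [L k] are separated from all
   but two of the others, so their measures are summable. *)
Lemma hausdorff2_halfspace (i : 'I_3) (t : R) :
  caratheodory_measurable (@hausdorff2 R) [set x : 'cV[R]_3 | x i 0 < t]%R.
Proof.
apply: le_caratheodory_measurable => X; set U := [set x | _].
suff : hausdorff2 (X `&` U) + hausdorff2 (X `&` ~` U) <= hausdorff2 X by [].
have [Xoo|] := eqVneq (hausdorff2 X) +oo; first by rewrite Xoo leey.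
rewrite -ltey => Xoo.
pose s (k : nat) : R := (t - k.+1%:R^-1)%R.
have sS k : (s k < s k.+1)%R.
  by rewrite ltrD2l ltrN2 ltf_pV2 ?posrE ?ltr0n// ltr_nat.
have st k : (s k < t)%R by rewrite ltrBlDr ltrDl invr_gt0.
pose B k := X `&` [set x : 'cV[R]_3 | x i 0 <= s k]%R.
pose L k := X `&` [set x : 'cV[R]_3 | s k < x i 0 <= s k.+1]%R.
have gap A A' (u v : R) : (u < v)%R -> (forall x, A x -> x i 0 <= u)%R ->
    (forall x, A' x -> v <= x i 0)%R ->
    hausdorff2 A + hausdorff2 A' <= hausdorff2 (A `|` A').
  move=> uv Au A'v; apply: (@hausdorff2_separated (v - u)).
    by rewrite subr_gt0.
  move=> a b /Au au /A'v bv; rewrite enormB.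
  apply: le_trans (coord_le_enorm _ i); rewrite !mxE.
  by rewrite (le_trans _ (ler_norm _))// lerB.
(* [L k.+1] touches [B k.+1], so it is compared with [B k]; the gap between them is
   [s k.+1 - s k]. *)
have gapL k : hausdorff2 (B k) + hausdorff2 (L k.+1) <= hausdorff2 (B k.+2).
  apply: le_trans (gap _ _ (s k) (s k.+1) _ _ _) _ => //.
  - by move=> x [].
  - by move=> x [_ /= /andP[/ltW]].
  apply: le_hausdorff2 => x [[Xx /= xs]|[Xx /= /andP[_ xs]]]; split => //=.
  by rewrite (le_trans xs)// ltW// (lt_trans (sS _)).
have BX k : hausdorff2 (B k) <= hausdorff2 X by apply: le_hausdorff2 => x [].
(* Layers of equal parity are separated from each other, hence one term on the right per parity; the
   induction step absorbs [B m] and [L m.+1] into [B m.+2]. *)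
have sumL m : \sum_(0 <= k < m.+1) hausdorff2 (L k) <=
    hausdorff2 (B m.+1) + hausdorff2 (B m).
  elim: m => [|m IH].
    rewrite big_nat1; apply: (@le_trans _ _ (hausdorff2 (B 1%N))).
      by apply: le_hausdorff2 => x [Xx /= /andP[_ xs]].
    by rewrite leeDl ?hausdorff2_ge0.
  rewrite big_nat_recr//=; apply: le_trans (leeD IH (lexx _)) _.
  by rewrite -addeA addeC leeD2r.
have Loo : \sum_(0 <= k <oo) hausdorff2 (L k) < +oo.
  apply: (@le_lt_trans _ _ (hausdorff2 X + hausdorff2 X)); last exact: lte_add_pinfty.
  apply: lime_le.
    by apply: is_cvg_nneseries => *; exact: hausdorff2_ge0.
  exists 1%N => // -[//|m] _ /=; apply: le_trans (sumL m) _; exact: leeD.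
have tail0 := nneseries_tail_cvg Loo (fun k _ => hausdorff2_ge0 (L k)).
have UE n : X `&` U `<=` B n `|` \bigcup_(k in ~` `I_n) L k.
  move=> x [Xx /= xt]; have [xs|xs] := leP (x i 0)%R (s n); first by left.
  right; pose P k := (x i 0 <= s k)%R.
  have exP : exists k, P k.
    exists (Num.truncn (t - x i 0)^-1)%R.
    rewrite /P /s lerBrDr addrC -lerBrDr -[leRHS]invrK lef_pV2 ?posrE ?invr_gt0 ?subr_gt0//.
    by rewrite ltW// truncnS_gt.
  (* The least index [k.+1] with x_i <= [s k.+1] places [x] in the layer [L k]; outside [B n] this
     index exceeds [n]. *)
  case: (ex_minnP exP) => k Pk kmin; case: k Pk kmin => [|k] Pk kmin.
    have : (s 0%N <= s n)%R.
      rewrite lerD2l lerN2 lef_pV2 ?posrE ?ltr0n// ler_nat//.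
    by rewrite leNgt (lt_le_trans xs Pk).
  have kx : (s k < x i 0)%R by rewrite ltNge; apply/negP => /kmin; rewrite ltnn.
  exists k => /=; last by split => //=; rewrite kx.
  move=> kn; have : (s k.+1 <= s n)%R.
    by rewrite lerD2l lerN2 lef_pV2 ?posrE ?ltr0n// ler_nat.
  by rewrite leNgt (lt_le_trans xs Pk).
have main n : hausdorff2 (X `&` U) + hausdorff2 (X `&` ~` U) <=
    hausdorff2 X + \sum_(n <= k <oo) hausdorff2 (L k).
  apply: (@le_trans _ _ (hausdorff2 (B n) + \sum_(n <= k <oo) hausdorff2 (L k)
      + hausdorff2 (X `&` ~` U))).
    rewrite leeD2r//; apply: le_trans (le_hausdorff2 (UE n)) _.
    apply: le_trans (outer_measureU2 _ _ _) _; rewrite leeD2l//.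
    exact: outer_measure_sigma_subadditive_tail.
  rewrite addeAC leeD2r//.
  apply: le_trans (gap _ _ (s n) t _ _ _) _ => //.
  - by move=> x [].
  - by move=> x [_ /= /negP]; rewrite -leNgt.
  by apply: le_hausdorff2 => x [[]|[]].
apply/lee_addgt0Pr => e e0.
have nbhs_e : nbhs (0 : \bar R) [set y | y < e%:E].
  apply: open_nbhs_nbhs; split; first exact: open_ereal_lt_ereal.
  by rewrite /= lte_fin.
have [n _ /(_ n (leqnn _)) /= tail_e] := tail0 _ nbhs_e.
by apply: le_trans (main n) _; rewrite leeD2l// ltW.
Qed.

(** The two sides carry the Caratheodory and the Borel sigma-algebra. Composing with this map makes
    every Borel function admissible under the integrals against [H2]. *)
Lemma measurable_H2_id :
  measurable_fun [set: H2space R] (fun x : H2space R => x : 'cV[R]_3).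
Proof.
apply: measurable_fun_colvec => i; apply: (measurability _ (RGenInftyO.measurableE R)).
move=> _ [_ [t ->] <-]; rewrite setTI.
rewrite (_ : _ @^-1` _ = [set x : 'cV[R]_3 | x i 0 < t]%R); first exact: hausdorff2_halfspace.
by apply/seteqP; split => x /=; rewrite in_itv.
Qed.

End hausdorff_borel.

(** * Rescaling of Lebesgue measure *)

Section change_of_variables.
Context {R : realType}.
Local Open Scope ereal_scope.

(** The law of [m2] is applied to each section, inside the integral, and that of [m1] is a change of
    variables for the outer integral. The generality allows two successive uses, for three
    coordinates. *)
Lemma product_measure_rescale d1 d2 (T1 : measurableType d1) (T2 : measurableType d2)
    (m1 : {measure set T1 -> \bar R}) (m2 : {sigma_finite_measure set T2 -> \bar R})
    (f1 : T1 -> T1) (f2 : T2 -> T2) (c1 c2 : R) :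
  (0 <= c1)%R -> (0 <= c2)%R ->
  measurable_fun setT f1 -> measurable_fun setT f2 ->
  (forall A, measurable A -> m1 A = c1%:E * m1 (f1 @^-1` A)) ->
  (forall A, measurable A -> m2 A = c2%:E * m2 (f2 @^-1` A)) ->
  forall X, measurable X -> (m1 \x m2) X =
    (c1 * c2)%:E * (m1 \x m2) ((fun q : T1 * T2 => (f1 q.1, f2 q.2)) @^-1` X).
Proof.
move=> c10 c20 mf1 mf2 h1 h2 X mX.
set F := fun q : T1 * T2 => (f1 q.1, f2 q.2).
have mF : measurable_fun setT F.
  by apply: measurable_fun_pair; apply: measurableT_comp.
have mFX : measurable (F @^-1` X) by rewrite -[X in measurable X]setTI; exact: mF.
pose m' := mscale (NngNum c10)
  (measure_function_pushforward__canonical__measure_function_Measure m1 mf1).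
have mx (Y : set (T1 * T2)) : measurable Y -> measurable_fun setT (m2 \o xsection Y).
  by move=> mY; exact: (@measurable_fun_xsection _ _ T1 T2 R m2 Y mY).
rewrite /product_measure1 (eq_measure_integral m'); last by move=> A mA _; exact: h1.
transitivity (c1%:E * \int[m1]_x m2 (xsection X (f1 x))).
  rewrite ge0_integral_mscale//; last exact: mx.
  congr (_ * _).
  by have := (ge0_integral_pushforward mf1 m1 measurableT (mx X mX)); apply=> x _; exact: measure_ge0.
transitivity (c1%:E * \int[m1]_x (c2%:E * m2 (xsection (F @^-1` X) x))).
  congr (_ * _); apply: eq_integral => x _; rewrite h2; last exact: measurable_xsection.
  by congr (_ * m2 _); apply/seteqP; split => y /=; rewrite /xsection /= !inE.
rewrite ge0_integralZl//; first by rewrite muleA -EFinM.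
exact: mx.
Qed.

Lemma measurable_affine (a r : R) :
  measurable_fun [set: R] (fun t : R => r * (a - t))%R.
Proof.
apply: measurable_funM => //; apply: measurable_funB => //.
Qed.

Lemma lebesgue_measure_rescale (a r : R) (A : set R) : (0 < r)%R -> measurable A ->
  lebesgue_measure A = r^-1%:E *
    lebesgue_measure ((fun t => r^-1 * (a - t))%R @^-1` A).
Proof.
move=> r0 mA; have r'0 : (0 <= r^-1)%R by rewrite invr_ge0 ltW.
pose f : measurableTypeR R -> measurableTypeR R := fun t => (r^-1 * (a - t))%R.
have mf : measurable_fun [set: measurableTypeR R] f := measurable_affine a r^-1.
pose m' := mscale (NngNum r'0)
  (measure_function_pushforward__canonical__measure_function_Measure
    (@lebesgue_measure R) mf).
suff m'E X : ocitv X -> lebesgue_measure X = m' X.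
  by rewrite (@lebesgue_measure_unique R m' m'E A mA).
move=> [[u v]] _ <-.
rewrite /m' /mscale /= /pushforward.
(* The map reverses the order, so the half-open interval changes its closed end; the length is not
   affected. *)
rewrite (_ : _ @^-1` _ = `[(a - r * v)%R, (a - r * u)%R[%classic); last first.
  apply/seteqP; split => t; rewrite /= !in_itv/= => /andP[h1 h2]; apply/andP; split.
  - by move: h2; rewrite ler_pdivrMl// => ?; lra.
  - by move: h1; rewrite ltr_pdivlMl// => ?; lra.
  - by rewrite ltr_pdivlMl//; lra.
  - by rewrite ler_pdivrMl//; lra.
rewrite !lebesgue_measure_itv/= !lte_fin ltrD2l ltrN2 ltr_pM2l//.
case: ifP => _; last by rewrite mule0.
by rewrite -!EFinB -EFinM; congr EFin; field; rewrite gt_eqF.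
Qed.

Lemma leb3_rescale (x : 'cV[R]_3) (r : R) (A : set 'cV[R]_3) :
  (0 < r)%R -> measurable A ->
  leb3 A = (r ^- 3)%:E * leb3 ((fun y => r^-1 *: (x - y))%R @^-1` A).
Proof.
move=> r0 mA; have r'0 : (0 <= r^-1)%R by rewrite invr_ge0 ltW.
have [t tE] : exists t : 'I_3 -> measurableTypeR R -> measurableTypeR R,
    t = fun i u => (r^-1 * (x i 0%R - u))%R by eexists.
have mt i : measurable_fun [set: measurableTypeR R] (t i).
  by rewrite tE; exact (measurable_affine (x i 0%R) r^-1).
have ht i (B : set (measurableTypeR R)) : measurable B ->
    lebesgue_measure B = r^-1%:E * lebesgue_measure (t i @^-1` B).
  by move=> mB; rewrite tE; exact: lebesgue_measure_rescale.
have [t2 t2E] : exists t2 : measurableTypeR R * measurableTypeR R ->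
    measurableTypeR R * measurableTypeR R,
    t2 = fun q => (t ord0 q.1, t (inord 1) q.2) by eexists.
have mt2 : measurable_fun [set: measurableTypeR R * measurableTypeR R] t2.
  by rewrite t2E; apply: measurable_fun_pair; apply: measurableT_comp.
have h2 := product_measure_rescale r'0 r'0 (mt ord0) (mt (inord 1)) (ht ord0) (ht (inord 1)).
rewrite -t2E in h2.
have h3 := product_measure_rescale (mulr_ge0 r'0 r'0) r'0 mt2 (mt ord_max) h2 (ht ord_max).
have F (q : R * R * R) : (r^-1 *: (x - colvec3 q))%R = colvec3 (t2 q.1, t ord_max q.2).
  have i1 : val (inord 1 : 'I_3) = 1%N by rewrite /= inordK.
  apply/colP => i; rewrite !mxE t2E tE !(tnth_nth 0%R).
  by case: i => -[|[|[|//]]] i3; congr (_ * (x _ _ - _))%R; apply: val_inj.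
have E : colvec3 @^-1` ((fun y => r^-1 *: (x - y))%R @^-1` A) =
    (fun q => (t2 q.1, t ord_max q.2)) @^-1` (colvec3 @^-1` A).
  by apply/funext => q; rewrite /preimage /mkset F.
rewrite /leb3 /pushforward E h3 /=; last first.
  by rewrite -[X in measurable X]setTI; exact: measurable_colvec3.
by rewrite (_ : r^-1 / r / r = r ^- 3)%R// -exprVn !exprS expr0 mulr1 mulrA.
Qed.

Lemma measurable_rescale (x : 'cV[R]_3) (r : R) :
  measurable_fun [set: 'cV[R]_3] (fun y => r^-1 *: (x - y))%R.
Proof.
apply: measurable_fun_colvec => i.
rewrite (_ : (fun y => _) = (fun y : 'cV[R]_3 => r^-1 * (x i 0 - y i 0))%R).
  exact: measurableT_comp (measurable_affine _ _) (measurable_coord i).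
by apply/funext => y; rewrite !mxE.
Qed.

Lemma ge0_integral_leb3_rescale (x : 'cV[R]_3) (r : R) (f : 'cV[R]_3 -> \bar R) :
  (0 < r)%R -> measurable_fun setT f -> (forall z, 0 <= f z) ->
  \int[leb3]_z f z = (r ^- 3)%:E * \int[leb3]_y f (r^-1 *: (x - y))%R.
Proof.
move=> r0 mf f0; have r'0 : (0 <= r ^- 3)%R by rewrite invr_ge0 exprn_ge0 ?ltW.
have mt := measurable_rescale x r.
pose m' := mscale (NngNum r'0)
  (measure_function_pushforward__canonical__measure_function_Measure leb3 mt).
rewrite (eq_measure_integral m'); last first.
  by move=> A mA _; exact: leb3_rescale.
rewrite (@ge0_integral_mscale _ _ _ _ setT measurableT (NngNum r'0) f mf); last by move=> *.
have E := ge0_integral_pushforward mt leb3 measurableT mf (fun z _ => f0 z).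
rewrite preimage_setT in E.
exact: (congr1 (fun z => (r ^- 3)%:E * z) E).
Qed.

(** Absolute value, positive part and negative part are nonnegative and positively homogeneous, so
    they commute with the factor [r ^- 3]; [key] reduces all three to the nonnegative case. *)
Lemma Rintegral_leb3_rescale (x : 'cV[R]_3) (r : R) (f : 'cV[R]_3 -> R) :
  (0 < r)%R -> leb3.-integrable setT (EFin \o f) ->
  leb3.-integrable setT (EFin \o (fun y : 'cV[R]_3 => r ^- 3 * f (r^-1 *: (x - y)))%R) /\
  (\int[leb3]_y (r ^- 3 * f (r^-1 *: (x - y))) = \int[leb3]_z f z)%R.
Proof.
move=> r0 /integrableP[mf foo].
have mf' := (measurable_EFinP _ _).1 mf.
have r'0 : (0 < r ^- 3)%R by rewrite invr_gt0 exprn_gt0.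
have mt := measurable_rescale x r.
have mft : measurable_fun setT (fun y : 'cV[R]_3 => f (r^-1 *: (x - y)))%R.
  exact: measurableT_comp mf' mt.
have mg : measurable_fun setT (EFin \o (fun y : 'cV[R]_3 => r ^- 3 * f (r^-1 *: (x - y)))%R).
  by apply/measurable_EFinP; exact: measurable_funM.
have key (h : R -> R) : (forall a b, 0 <= a -> h (a * b) = a * h b)%R ->
    (forall b, 0 <= h b)%R -> measurable_fun setT h ->
    \int[leb3]_y (h (r ^- 3 * f (r^-1 *: (x - y))))%:E = \int[leb3]_z (h (f z))%:E.
  move=> hM h0 mh.
  have mhf : measurable_fun setT (EFin \o (h \o f)).
    by apply/measurable_EFinP; exact: measurableT_comp.
  have mhft : measurable_fun setT (EFin \o (fun y : 'cV[R]_3 => h (f (r^-1 *: (x - y)))%R)).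
    by apply/measurable_EFinP; exact: (measurableT_comp mh mft).
  rewrite (ge0_integral_leb3_rescale x r0 mhf); last by move=> z; rewrite /= lee_fin h0.
  rewrite -ge0_integralZl//; last 2 first.
  - by move=> y _; rewrite /= lee_fin h0.
  - by rewrite lee_fin ltW.
  by apply: eq_integral => y _ /=; rewrite hM ?ltW// EFinM.
have ig : leb3.-integrable setT (EFin \o (fun y : 'cV[R]_3 => r ^- 3 * f (r^-1 *: (x - y)))%R).
  apply/integrableP; split => //=.
  rewrite (key (fun z => `|z|)%R)//; last by move=> a b a0; rewrite normrM ger0_norm.
split => //; rewrite /Rintegral; congr fine.
rewrite integralE [RHS]integralE.
have posE (u : 'cV[R]_3 -> R) :
    \int[leb3]_y (EFin \o u)^\+ y = \int[leb3]_y (Num.max (u y) 0)%:E.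
  by apply: eq_integral => y _; rewrite funeposE /= EFin_max.
have negE (u : 'cV[R]_3 -> R) :
    \int[leb3]_y (EFin \o u)^\- y = \int[leb3]_y (Num.max (- u y) 0)%:E.
  by apply: eq_integral => y _; rewrite funenegE /= EFin_max EFinN.
rewrite !posE !negE; congr (_ - _).
  apply: (key (fun z => Num.max z 0)%R) => [a b a0|b|].
  - by rewrite maxr_pMr// mulr0.
  - by rewrite le_max lexx orbT.
  - by apply: measurable_maxr.
apply: (key (fun z => Num.max (- z) 0)%R) => [a b a0|b|].
- by rewrite -mulrN maxr_pMr// mulr0.
- by rewrite le_max lexx orbT.
- by apply: measurable_maxr.
Qed.

Lemma leb3_bounded (A : set 'cV[R]_3) (M : R) : measurable A ->
  (forall x, A x -> `|x| <= M)%R -> leb3 A < +oo.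
Proof.
move=> mA AM; pose I : set (measurableTypeR R) := `[(- M)%R, M]%classic.
have mI : measurable I by exact: measurable_itv.
have mI2 : measurable (I `*` I) by exact: measurableX.
have mII : measurable ((I `*` I) `*` I) by exact: measurableX.
apply: (@le_lt_trans _ _ (((@lebesgue_measure R \x @lebesgue_measure R) \x
    @lebesgue_measure R) ((I `*` I) `*` I))).
  rewrite /leb3 /pushforward.
  apply: (le_measure ((@lebesgue_measure R \x @lebesgue_measure R) \x
    @lebesgue_measure R)); rewrite ?inE.
  - by rewrite -[X in measurable X]setTI; exact: measurable_colvec3.
  - exact: mII.
  move=> q /AM qM; have h i : (`|colvec3 q i 0| <= M)%R.
    by apply: le_trans qM; exact: entry_le_norm.
  have := h ord0; have := h (inord 1); have := h ord_max.
  rewrite !mxE !(tnth_nth 0%R) /= inordK//= !ler_norml => h1 h2 h3.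
  by split; [split|]; rewrite /I /= in_itv.
have Ioo : (@lebesgue_measure R) I < +oo.
  by rewrite lebesgue_measure_itv/=; case: ifP => _; rewrite -?EFinB ltry.
rewrite !product_measure1E//.
have fI : (@lebesgue_measure R) I \is a fin_num by rewrite ge0_fin_numE.
have fII := fin_numM fI fI.
rewrite -(product_measure1E (@lebesgue_measure R) (@lebesgue_measure R) mI mI) in fII.
by apply: lte_mul_pinfty => //; exact: fII.
Qed.

End change_of_variables.

(** * Matrix-valued maps *)

Section matrix_topology.
Context {R : realType}.

Lemma norm_mulmx_le m n k (A : 'M[R]_(m, n)) (B : 'M[R]_(n, k)) :
  `|A *m B| <= n%:R * (`|A| * `|B|).
Proof.
apply: norm_le_entry => [|i j]; first by rewrite !mulr_ge0.
rewrite mxE; apply: le_trans (ler_norm_sum _ _ _) _.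
rewrite mulr_natl -[X in _ *+ X]card_ord -sumr_const.
by apply: ler_sum => l _; rewrite normrM ler_pM ?entry_le_norm.
Qed.

Lemma cvg_mx (T : Type) (F : set_system T) (FF : Filter F) m n
    (A : T -> 'M[R]_(m, n)) (B : 'M[R]_(m, n)) :
  (forall i j, A t i j @[t --> F] --> B i j) -> A t @[t --> F] --> B.
Proof.
move=> AB; apply/cvgrPdist_le => e e0.
have : \forall t \near F, forall i j, `|B i j - A t i j| <= e.
  apply: filter_forall => i; apply: filter_forall => j.
  by move/cvgrPdist_le : (AB i j); exact.
apply: filterS => t At; apply: norm_le_entry => [|i j]; first exact: ltW.
by rewrite !mxE.
Qed.

Lemma cvg_entry (T : Type) (F : set_system T) (FF : Filter F) m n
    (A : T -> 'M[R]_(m, n)) (B : 'M[R]_(m, n)) i j :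
  A t @[t --> F] --> B -> A t i j @[t --> F] --> B i j.
Proof.
move=> /cvgrPdist_le AB; apply/cvgrPdist_le => e e0; apply: filterS (AB _ e0) => t.
by apply: le_trans; rewrite (_ : B i j - A t i j = (B - A t) i j) ?entry_le_norm// !mxE.
Qed.

Lemma cvg_mulmx (T : Type) (F : set_system T) (FF : Filter F) m n k
    (A : T -> 'M[R]_(m, n)) (A' : 'M[R]_(m, n))
    (B : T -> 'M[R]_(n, k)) (B' : 'M[R]_(n, k)) :
  A t @[t --> F] --> A' -> B t @[t --> F] --> B' ->
  A t *m B t @[t --> F] --> A' *m B'.
Proof.
move=> AA' BB'; apply: cvg_mx => i j; rewrite mxE.
under eq_fun do rewrite mxE.
apply: cvg_big => [|l _]; first exact: add_continuous.
by apply: cvgM; exact: cvg_entry.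
Qed.

Lemma lipschitz_le m n (V : normedModType R) (f : 'M[R]_(m, n) -> V) A :
  [lipschitz f x | x in A] -> exists2 k, 0 <= k &
    forall x y, A x -> A y -> `|f x - f y| <= k * `|x - y|.
Proof.
case=> k0 [_ /(_ (Num.max (k0 + 1) 0))]; rewrite /globally /= => h.
exists (Num.max (k0 + 1) 0); first by rewrite le_max lexx orbT.
by move=> x y Ax Ay; apply: (h _ (x, y)) => //; rewrite lt_max ltrDl ltr01.
Qed.

Lemma lipschitz_cvg (T : Type) (F : set_system T) (FF : Filter F) m n
    (f : 'M[R]_(m, n) -> R) (A : T -> 'M[R]_(m, n)) (B : 'M[R]_(m, n)) :
  lipschitz f -> A t @[t --> F] --> B -> f (A t) @[t --> F] --> f B.
Proof.
move=> /lipschitz_le[k k0 fk] /cvgrPdist_le AB; apply/cvgrPdist_le => e e0.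
have k1 : 0 < k + 1 by lra.
apply: filterS (AB (e / (k + 1)) (divr_gt0 e0 k1)) => t.
rewrite ler_pdivlMr// => h; apply: le_trans (fk _ _ _ _) _ => //.
apply: le_trans h; rewrite mulrC ler_wpM2l//; lra.
Qed.

Lemma lipschitz_bounded m n p q (f : 'M[R]_(m, n) -> 'M[R]_(p, q)) A :
  bounded_set A -> [lipschitz f x | x in A] ->
  exists2 M, 0 <= M & forall x, A x -> `|f x| <= M.
Proof.
move=> [c [_ /(_ (c + 1))]]; rewrite ltrDl ltr01 => /(_ isT) Ac /lipschitz_le[k k0 fk].
have [->|/set0P[x0 Ax0]] := eqVneq A set0; first by exists 0.
exists (`|f x0| + k * ((c + 1) + (c + 1))).
  by rewrite addr_ge0// mulr_ge0// addr_ge0// (le_trans _ (Ac _ Ax0)).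
move=> x Ax; have -> : f x = f x0 + (f x - f x0) by rewrite addrC subrK.
apply: le_trans (ler_normD _ _) _; rewrite lerD2l.
apply: le_trans (fk _ _ Ax Ax0) _; rewrite ler_wpM2l//.
by apply: le_trans (ler_normB _ _) _; rewrite lerD ?Ac.
Qed.

Lemma dist_continuous_at m n (V : normedModType R) (f : 'M[R]_(m, n) -> V) x :
  (forall e, 0 < e -> nbhs x [set y | `|f x - f y| <= e]) -> {for x, continuous f}.
Proof.
move=> fx; have FF : Filter (nbhs x) by exact: nbhs_filter.
by apply/cvgrPdist_le => e e0; exact: fx.
Qed.

Lemma lipschitz_continuous_at m n p q (f : 'M[R]_(m, n) -> 'M[R]_(p, q)) A x :
  open A -> A x -> [lipschitz f x | x in A] -> {for x, continuous f}.
Proof.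
move=> oA Ax /lipschitz_le[k k0 fk]; apply: dist_continuous_at => e e0; have k1 : 0 < k + 1 by lra.
move: oA; rewrite openE => /(_ _ Ax) /nbhs_ballP[d /= d0 dA].
apply/nbhs_ballP; exists (Num.min d (e / (k + 1))) => [|y].
  by rewrite /= lt_min d0 divr_gt0.
rewrite -ball_normE /= lt_min => /andP[yd]; rewrite ltr_pdivlMr// => ye.
have Ay : A y by apply: dA; rewrite -ball_normE.
apply: le_trans (fk _ _ Ax Ay) _; apply/ltW/le_lt_trans/ye.
by rewrite mulrC ler_wpM2l//; lra.
Qed.

(** Transposition is continuous and preserves the sup norm, which carries Heine-Borel over from row
    vectors. *)
Lemma bounded_closed_compact_col n (A : set 'cV[R]_n) (M : R) :
  (forall x, A x -> `|x| <= M) -> closed A -> compact A.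
Proof.
move=> AM cA.
have tr_cont p q : continuous (trmx : 'M[R]_(p, q) -> 'M[R]_(q, p)).
  move=> x; have FF : Filter (nbhs x) by exact: nbhs_filter.
  apply: cvg_mx => i j; rewrite mxE; under eq_fun do rewrite mxE.
  exact: coord_continuous.
have -> : A = trmx @` (trmx @^-1` A).
  apply/seteqP; split => [x Ax|_ [y Ay <-]//].
  by exists x^T => //=; rewrite trmxK.
apply: continuous_compact; first by apply: continuous_subspaceT; exact: tr_cont.
apply: bounded_closed_compact; last first.
  by apply: closed_comp => // x _; exact: tr_cont.
exists M; split; first exact: num_real.
move=> c Mc x /= /AM xM; apply: le_trans (ltW Mc); apply: le_trans xM.
by apply: norm_le_entry => // i j; have := entry_le_norm x^T j i; rewrite mxE.
Qed.

End matrix_topology.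

(** * Geometry of the domain *)

Section domain.
Context {R : realType}.
Implicit Types (Om : set 'cV[R]_3) (x y : 'cV[R]_3) (r : R).

Lemma boundary_open Om : open Om -> boundary Om = closure Om `\` Om.
Proof. by move=> oOm; rewrite /boundary (interior_id _).1. Qed.

(** The strict inequality on an infimum becomes a margin [e], uniform over the boundary, which later
    estimates can spend. *)
Lemma innerP Om r x : inner Om r x <->
  Om x /\ exists2 e, 0 < e & forall y, boundary Om y -> r + e <= enorm (x - y).
Proof.
split=> [[Omx]|[Omx [e e0 h]]]; last first.
  split => //; apply: (@lt_le_trans _ _ (r + e)%:E).
    by rewrite lte_fin ltrDl.
  by apply: le_ereal_inf_tmp => _ [y By <-]; rewrite lee_fin; exact: h.
have lb y : boundary Om y -> (dist_set x (boundary Om) <= (enorm (x - y))%:E)%E.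
  by move=> By; apply: ereal_inf_lbound; exists y.
case: (dist_set _ _) lb => [d| |] //= lb rd; split => //.
  exists (d - r); first by rewrite subr_gt0 -lte_fin.
  by move=> y /lb; rewrite lee_fin => ?; rewrite addrC subrK.
(* Infinite distance: there is no boundary point, and any margin does. *)
exists 1 => // y /lb; by rewrite leye_eq.
Qed.

Lemma open_inner Om r : open Om -> open (inner Om r).
Proof.
move=> oOm; rewrite openE => x /innerP[Omx [e e0 h]].
have e2 : 0 < e / 2 by rewrite divr_gt0.
have FF : Filter (nbhs x) by exact: nbhs_filter.
suff : nbhs x (inner Om r) by [].
apply: filterS (filterI (open_nbhs_nbhs (conj oOm Omx)) (nbhs_eball x e2)) => y [Omy xy].
apply/innerP; split => //; exists (e / 2) => // z /h.
have := enorm_triangle (x - y) (y - z); rewrite addrA subrK (enormB x y).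
by move: xy; rewrite /eball /= => ? ? ?; lra.
Qed.

Lemma near_inner Om x : open Om -> Om x -> exists2 d, 0 < d &
  forall r, r < d -> inner Om r x.
Proof.
move=> oOm Omx; have /nbhs_eballP[d d0 dOm] := open_nbhs_nbhs (conj oOm Omx).
exists d => // r rd; apply/innerP; split => //; exists (d - r); first by rewrite subr_gt0.
move=> y; rewrite boundary_open// => -[_ Omy]; rewrite addrC subrK leNgt.
by apply/negP => xy; apply: Omy; apply: dOm; rewrite /eball /= enormB.
Qed.

(* The segment from the centre cannot leave [Om] without crossing the boundary. *)
Lemma eball_sub_inner Om r x : open Om -> inner Om r x -> eball x r `<=` Om.
Proof.
move=> oOm /innerP[Omx [e e0 h]] y xy.
pose c (t : R) : 'cV[R]_3 := x + t *: (y - x).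
have cc : continuous c.
  move=> t; apply: cvgD; first exact: cvg_cst.
  by apply: cvgZr_tmp; exact: cvg_id.
(* The segment stays within [r] of [x], where there is no boundary point. The times spent in [Om]
   therefore form a set both open and closed in [0, 1]. *)
have clE : `[0, 1] `&` c @^-1` Om = `[0, 1] `&` c @^-1` closure Om.
  apply/seteqP; split => t [t01 Omt]; split => //; first exact: subset_closure.
  apply: contrapT => nOmt.
  have /h : boundary Om (c t) by rewrite boundary_open.
  rewrite enormB /c addrAC subrr add0r enormZ.
  move: t01; rewrite /= in_itv/= => /andP[t0 t1]; rewrite ger0_norm//.
  have := enorm_ge0 (y - x); move: xy; rewrite /eball /=.
  move: (enorm _) => u ur u0; nra.
have := @segment_connected R 0 1 (`[0, 1] `&` c @^-1` Om).
move=> /(_ _ _ _)/seteqP; case.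
- by exists 0; split; [rewrite /= in_itv/= lexx ler01|rewrite /c /= scale0r addr0].
- exists (c @^-1` Om) => //; apply: open_comp => // t _; exact: cc.
- exists (c @^-1` closure Om) => //; apply: closed_comp; last exact: closed_closure.
  by move=> t _; exact: cc.
move=> _ /(_ 1) []; first by rewrite /= in_itv/= lexx ler01.
by move=> _; rewrite /c /= scale1r addrC subrK.
Qed.

Lemma disc_set_continuous Om (g : 'cV[R]_3 -> 'cV[R]_3) : open Om ->
  (forall x, Om x -> {for x, continuous g}) -> disc_set Om g = set0.
Proof.
move=> oOm cg; apply/seteqP; split => // x [Omx []]; exists (g x).
apply/cvgrPdist_le => e e0.
have [d d0 dP] : exists2 d, 0 < d &
    eball x d `<=` Om `&` [set y | enorm (g y - g x) <= e].
  apply/nbhs_eballP; have FF : Filter (nbhs x) by exact: nbhs_filter.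
  apply: filterI; first exact: open_nbhs_nbhs.
  have /cvgrPdist_lt/(_ (e / 2)) := cg x Omx.
  rewrite divr_gt0// => /(_ isT).
  suff S : [set y | `|g x - g y| < e / 2] `<=` [set y | enorm (g y - g x) <= e].
    by apply: filterS => y; exact: S.
  move=> y; rewrite /= enormB => h; apply: le_trans (enorm_le_norm _) _; lra.
near=> r.
have rd : r < d by near: r; exact: nbhs_right_lt.
have r0 : 0 < r by near: r; exact: nbhs_right_gt.
rewrite sub0r normrN ger0_norm; last first.
  apply: divr_ge0; last exact: fine_ge0.
  by apply: Rintegral_ge0 => y _; exact: enorm_ge0.
have sub y : eball x r y -> Om y /\ enorm (g y - g x) <= e.
  by move=> yr; apply: dP; exact: lt_trans yr rd.
have mB : measurable (eball x r) by apply: open_measurable_colvec; exact: open_eball.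
rewrite /mean_osc.
(* Both [fine +oo] and the inverse of 0 are 0, so a ball of infinite or zero measure would have mean
   oscillation 0; volumes of balls need not be computed. *)
have [Boo|Boo] := eqVneq (leb3 (eball x r)) +oo%E.
  by rewrite Boo /= invr0 mulr0 ltW.
have Bfin : leb3 (eball x r) \is a fin_num.
  by rewrite ge0_fin_numE// ltey.
have [->|B0] := eqVneq (fine (leb3 (eball x r))) 0; first by rewrite invr0 mulr0 ltW.
have Bgt0 : 0 < fine (leb3 (eball x r)) by rewrite lt_neqAle eq_sym B0 fine_ge0.
rewrite ler_pdivrMr// -Rintegral_cst//.
have ie : leb3.-integrable (eball x r) (EFin \o (fun=> e)).
  by apply: measurable_bounded_integrable => //; [rewrite ltey|exact: bounded_cst].
apply: le_Rintegral => //; last by move=> y /sub[].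
apply: dominated_integrable ie _ => //.
  apply: open_continuous_measurable_colvec; first exact: open_eball.
  move=> y /sub[Omy _]; apply: continuous_comp; last exact: enorm_continuous.
  have FF : Filter (nbhs y) by exact: nbhs_filter.
  have cgy : g z - g x @[z --> y] --> g y - g x.
    by apply: cvgB; [exact: cg _ Omy|exact: cvg_cst].
  exact: cgy.
by move=> y /sub[_ ye]; rewrite !ger0_norm ?enorm_ge0// ltW.
Unshelve. all: by end_near. Qed.

End domain.

(** * Pairings and convolutions *)

Section pairing.
Context d (T : measurableType d) (R : realType) (mu : {measure set T -> \bar R}).
Context (D : set T) (mD : measurable D) (J : T -> R).
Context (iJ : mu.-integrable D (EFin \o J)).

Let mJ : measurable_fun D J.
Proof. by case/integrableP : iJ => /measurable_EFinP. Qed.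

Lemma pairing_bound (phi : T -> R) M : measurable_fun D phi -> 0 <= M ->
  (forall x, D x -> `|phi x| <= M) ->
  mu.-integrable D (EFin \o (fun x => phi x * J x)) /\
  `|\int[mu]_(x in D) (phi x * J x)| <= M * \int[mu]_(x in D) `|J x|.
Proof.
move=> mphi M0 phiM; apply: le_Rintegral_bound => //; first exact: measurable_funM.
by move=> x Dx; rewrite normrM ler_wpM2r// phiM.
Qed.

Lemma pairing_cvg (phi : nat -> T -> R) (psi : T -> R) M :
  (forall n, measurable_fun D (phi n)) -> 0 <= M ->
  (forall n x, D x -> `|phi n x| <= M) ->
  (forall x, D x -> phi n x @[n --> \oo] --> psi x) ->
  \int[mu]_(x in D) (phi n x * J x) @[n --> \oo] --> \int[mu]_(x in D) (psi x * J x).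
Proof.
move=> mphi M0 phiM phipsi.
have iM : mu.-integrable D (EFin \o (fun x => M * `|J x|)).
  have := integrableZl mD M (integrable_abse iJ).
  by apply: eq_integrable => // x _ /=; rewrite EFinM.
apply: (Rdominated_convergence mD _ _ iM _).2.
- by move=> n; exact: measurable_funM.
- by move=> x Dx; apply: cvgM; [exact: phipsi|exact: cvg_cst].
- by move=> n x Dx; rewrite normrM ler_wpM2r// phiM.
Qed.

Lemma pairing_sum (c : nat -> R) (phi : nat -> T -> R) M N :
  (forall n, measurable_fun D (phi n)) -> 0 <= M ->
  (forall n x, D x -> `|phi n x| <= M) ->
  \int[mu]_(x in D) ((\sum_(k < N) c k * phi k x) * J x) =
  \sum_(k < N) c k * \int[mu]_(x in D) (phi k x * J x).
Proof.
move=> mphi M0 phiM.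
have iphi k := (pairing_bound (mphi k) M0 (phiM k)).1.
have ic k : mu.-integrable D (EFin \o (fun x => c k * (phi k x * J x))).
  by have := integrableZl mD (c k) (iphi k); apply: eq_integrable => // x _ /=; rewrite EFinM.
(* Integrability of the partial sums joins the induction, because additivity of the integral asks
   for it. *)
suff [] : mu.-integrable D (EFin \o (fun x => (\sum_(k < N) c k * phi k x) * J x)) /\
  \int[mu]_(x in D) ((\sum_(k < N) c k * phi k x) * J x) =
  \sum_(k < N) c k * \int[mu]_(x in D) (phi k x * J x) by [].
elim: N => [|N [iS IH]].
  have E : (fun x => (\sum_(k < 0) c k * phi k x) * J x) = cst 0.
    by apply/funext => x; rewrite big_ord0 mul0r.
  by rewrite E big_ord0; split; [exact: integrable0|rewrite Rintegral_cst// mul0r].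
have E : (fun x => (\sum_(k < N.+1) c k * phi k x) * J x) =
    (fun x => (\sum_(k < N) c k * phi k x) * J x + c N * (phi N x * J x)).
  by apply/funext => x; rewrite big_ord_recr mulrDl mulrA.
rewrite E big_ord_recr /= -IH -RintegralZl// -RintegralD//; split => //.
by have := integrableD mD iS (ic N); apply: eq_integrable => // x _ /=.
Qed.

End pairing.

(** * Geometric series and sequential continuity *)

Section sequences.
Context {R : realType}.

Lemma small_quarter (C e : R) : 0 <= C -> 0 < e -> exists N, C * 4^-1 ^+ N < e.
Proof.
move=> C0 e0; exists (Num.truncn (C / e)).+1; have := truncnS_gt (C / e).
move: (Num.truncn (C / e)).+1 => N CN.
have N4 : N%:R <= 4 ^+ N :> R by rewrite -natrX ler_nat ltnW// ltn_expl.
rewrite exprVn ltr_pdivrMr ?exprn_gt0//.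
by move: CN; rewrite ltr_pdivrMr// => CN; apply: lt_le_trans CN _; rewrite mulrC ler_pM2l.
Qed.

(** Weierstrass' test with an explicit rate. The sharp constant is 4/3; with 2 the bound telescopes,
    since 2 (1 - 1/4) >= 1. *)
Lemma geometric_series_uniform (X : Type) (c : nat -> R) (f : nat -> X -> R) (M : R) :
  0 <= M -> (forall k, `|c k| <= 4^-1 ^+ k) -> (forall k x, `|f k x| <= M) ->
  exists F : X -> R,
    (forall x, \sum_(k < N) c k * f k x @[N --> \oo] --> F x) /\
    forall x N, `|F x - \sum_(k < N) c k * f k x| <= 2 * M * 4^-1 ^+ N.
Proof.
move=> M0 cle fM.
pose S x N := \sum_(k < N) c k * f k x.
have q0 N : (0 : R) <= 4^-1 ^+ N by rewrite exprn_ge0 ?invr_ge0.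
have tail x N i : `|S x (N + i)%N - S x N| <= 2 * M * 4^-1 ^+ N - 2 * M * 4^-1 ^+ (N + i).
  elim: i => [|i IH].
    by rewrite addn0 !subrr normr0.
  rewrite addnS /S big_ord_recr /= -/(S x (N + i)%N) -/(S x N) addrAC.
  apply: le_trans (ler_normD _ _) _.
  have h : `|c (N + i)%N * f (N + i)%N x| <= M * 4^-1 ^+ (N + i).
    by rewrite normrM mulrC ler_pM.
  rewrite exprS; have := mulr_ge0 M0 (q0 (N + i)%N); move: IH h.
  by move: (4^-1 ^+ (N + i)) (4^-1 ^+ N) => a b; lra.
have tail' x N n : (N <= n)%N -> `|S x n - S x N| <= 2 * M * 4^-1 ^+ N.
  move=> Nn; rewrite -(subnKC Nn); apply: le_trans (tail _ _ _) _.
  by rewrite gerBl !mulr_ge0.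
have cS x : cvgn (S x).
  have -> : S x = series (fun k => c k * f k x).
    by apply/funext => n; rewrite /series /= big_mkord.
  apply: normed_cvg; apply: (series_le_cvg _ _ _ (@is_cvg_geometric_series R M 4^-1 _)).
  - by move=> n; exact: normr_ge0.
  - by move=> n; rewrite /= mulr_ge0.
  - by move=> n; rewrite /= normrM mulrC ler_pM.
  - by rewrite ger0_norm ?invr_ge0// invf_lt1// ltr1n.
exists (fun x => limn (S x)); split => // x N.
have cvd : `|S x n - S x N| @[n --> \oo] --> `|limn (S x) - S x N|.
  by apply: cvg_norm; apply: cvgB; [exact: cS|exact: cvg_cst].
apply: (cvgr_to_le cvd); near=> n; apply: tail'.
by near: n; exact: nbhs_infty_ge.
Unshelve. all: by end_near. Qed.

Lemma cvg_enorm_seq (u : nat -> 'cV[R]_3) x :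
  (forall n, enorm (u n - x) < n.+1%:R^-1) -> u n @[n --> \oo] --> x.
Proof.
move=> ux; apply/cvgrPdist_lt => e e0; near=> n.
rewrite distrC; apply: le_lt_trans (norm_le_enorm _) _; apply: lt_trans (ux n) _.
near: n; exists (Num.truncn e^-1) => // n /= en.
rewrite -[ltRHS]invrK ltf_pV2 ?posrE ?invr_gt0//.
by apply: lt_le_trans (truncnS_gt _) _; rewrite ler_nat.
Unshelve. all: by end_near. Qed.

(** Dominated convergence speaks of sequences only; this brings it to bear on the continuity of
    convolutions. *)
Lemma seq_continuous_at (f : 'cV[R]_3 -> R) x :
  (forall u : nat -> 'cV[R]_3, u n @[n --> \oo] --> x ->
    f (u n) @[n --> \oo] --> f x) ->
  {for x, continuous f}.
Proof.
move=> fx; apply: dist_continuous_at => e e0; apply: contrapT => nfx.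
have /choice[u uP] : forall n : nat, exists y,
    enorm (y - x) < n.+1%:R^-1 /\ ~ `|f x - f y| <= e.
  move=> n; apply: contrapT => /forallNP h; apply: nfx; apply/nbhs_eballP.
  exists n.+1%:R^-1; first by rewrite invr_gt0.
  by move=> y xy /=; apply: contrapT => ?; apply: (h y).
have /fx/cvgrPdist_le/(_ _ e0) : u n @[n --> \oo] --> x.
  by apply: cvg_enorm_seq => n; case: (uP n).
by case=> n _ /(_ n (leqnn _)) /=; case: (uP n).
Qed.

Lemma continuous_subl (beta : 'cV[R]_3 -> R) (x : 'cV[R]_3) :
  continuous beta -> continuous (fun y : 'cV[R]_3 => beta (x - y)).
Proof.
move=> cb y; have FF : Filter (nbhs y) by exact: nbhs_filter.
have cxy : x - z @[z --> y] --> x - y by apply: cvgB; [exact: cvg_cst|exact: cvg_id].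
exact: (continuous_comp cxy (cb _)).
Qed.

End sequences.

(** * Continuity of convolutions with respect to a general measure *)

Section convolution.
Context d (T : measurableType d) (R : realType) (mu : {measure set T -> \bar R}).
Context (D : set T) (mD : measurable D) (J : T -> R).
Context (iJ : mu.-integrable D (EFin \o J)).
Context (i : T -> 'cV[R]_3) (mi : measurable_fun setT i).

(** In both uses [i] is the identity of R^3; it is kept as a map because [T] carries the Borel
    sigma-algebra in one case and the Caratheodory one in the other. *)
Lemma measurable_convolution_kernel (beta : 'cV[R]_3 -> R) (x : 'cV[R]_3) :
  continuous beta -> measurable_fun D (fun y => beta (x - i y)).
Proof.
move=> cb; apply: measurable_funTS.
apply: (measurableT_comp (f := fun y : 'cV[R]_3 => beta (x - y))) => //.
by apply: open_continuous_measurable_colvec; [exact: openT|move=> y _; exact: continuous_subl].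
Qed.

Lemma convolution_continuous (beta : 'cV[R]_3 -> R) M :
  continuous beta -> 0 <= M -> (forall z, `|beta z| <= M) ->
  continuous (fun x : 'cV[R]_3 => \int[mu]_(y in D) (beta (x - i y) * J y)).
Proof.
move=> cb M0 bM x; apply: seq_continuous_at => u ux.
apply: (pairing_cvg mD iJ) M0 _ _ => [n|n y _|y _].
- exact: measurable_convolution_kernel.
- exact: bM.
have uxy : u n - i y @[n --> \oo] --> x - i y.
  by apply: cvgB => //; exact: cvg_cst.
exact: (continuous_cvg _ (cb _) uxy).
Qed.

End convolution.

(** * Mollifiers and singular convolutions *)

Section mollifiers.
Context {R : realType} (alpha : 'cV[R]_3 -> R).
Context (sa : smooth alpha) (spta : spt alpha `<=` eball 0 1).
Implicit Types (x y z : 'cV[R]_3) (r : R).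

Let ca : continuous alpha. Proof. exact: sa 0%N. Qed.

Lemma smooth_spt_bounded : exists2 M, 0 <= M & forall z, `|alpha z| <= M.
Proof.
have cpt : compact (spt alpha).
  apply: (@bounded_closed_compact_col _ _ _ 1); last exact: closed_closure.
  move=> z /spta; rewrite /eball /= subr0 => /ltW; apply: le_trans.
  exact: norm_le_enorm.
have [M [_ /(_ (M + 1))]] : bounded_set (alpha @` spt alpha).
  by apply: compact_bounded; apply: continuous_compact => //; exact: continuous_subspaceT.
rewrite ltrDl ltr01 => /(_ isT) aM.
exists `|M + 1| => // z; have [->|az] := eqVneq (alpha z) 0; first by rewrite normr0.
apply: le_trans (ler_norm _); apply: aM; exists z => //.
by apply: (@subset_closure _ [set x | alpha x != 0]).
Qed.

Lemma mollifier_continuous r : continuous (mollifier alpha r).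
Proof.
move=> z; have FF : Filter (nbhs z) by exact: nbhs_filter.
have cz : r^-1 *: y @[y --> z] --> r^-1 *: z by apply: cvgZl_tmp; exact: cvg_id.
have caz : alpha (r^-1 *: y) @[y --> z] --> alpha (r^-1 *: z).
  by apply: (cvg_comp _ _ cz); exact: ca.
by apply: cvgM caz; exact: cvg_cst.
Qed.

Lemma mollifier_bounded r : exists2 M, 0 <= M & forall z, `|mollifier alpha r z| <= M.
Proof.
have [M M0 aM] := smooth_spt_bounded.
exists (`|r ^- 3| * M); first exact: mulr_ge0.
by move=> z; rewrite normrM ler_wpM2l.
Qed.

Lemma mollifier_support r z : 0 < r -> mollifier alpha r z != 0 -> enorm z < r.
Proof.
move=> r0; rewrite mulf_eq0 negb_or => /andP[_ az].
have : spt alpha (r^-1 *: z) by apply: (@subset_closure _ [set x | alpha x != 0]).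
move=> /spta; rewrite /eball /= subr0 enormZ gtr0_norm ?invr_gt0//.
by rewrite ltr_pdivrMl// mulr1.
Qed.

(** [K] is the preimage of the support of [alpha], not a ball: it is closed, and lies in the open
    ball of radius [r] because the support lies in the open unit ball. *)
Lemma mollifier_compact_support Om r x : open Om -> 0 < r -> inner Om r x ->
  exists K, [/\ compact K, K `<=` Om & forall y, ~ K y -> mollifier alpha r (x - y) = 0].
Proof.
move=> oOm r0 xin; pose f y := r^-1 *: (x - y).
have cf : continuous f.
  move=> y; have FF : Filter (nbhs y) by exact: nbhs_filter.
  by apply: cvgZl_tmp; apply: cvgB; [exact: cvg_cst|exact: cvg_id].
have Kball y : spt alpha (f y) -> enorm (y - x) < r.
  move=> /spta; rewrite /eball /= subr0 enormZ gtr0_norm ?invr_gt0// enormB.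
  by rewrite ltr_pdivrMl// mulr1.
exists (f @^-1` spt alpha); split.
- apply: (@bounded_closed_compact_col _ _ _ (r + enorm x)).
    move=> y /Kball yr; apply: le_trans (norm_le_enorm _) _.
    have := enorm_triangle (y - x) x; rewrite subrK; lra.
  by apply: closed_comp; [move=> y _; exact: cf|exact: closed_closure].
- by move=> y /Kball yr; apply: eball_sub_inner oOm xin _ yr.
- move=> y Ky; apply/eqP; rewrite mulf_eq0; apply/orP; right.
  apply: contrapT => /negP az; apply: Ky.
  exact: (@subset_closure _ [set x | alpha x != 0]).
Qed.

Lemma mollifier_C0 Om r x : open Om -> 0 < r -> inner Om r x ->
  C0_fun Om (fun y => mollifier alpha r (x - y)).
Proof.
move=> oOm r0 xin; split => [y _|e e0].
  by apply: continuous_subl; exact: mollifier_continuous.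
have [K [cK KOm K0]] := mollifier_compact_support oOm r0 xin.
by exists K; split => // y _ /K0 ->; rewrite normr0.
Qed.

(** C_0(Om) is stable under uniform limits: continuity passes to the limit, and off the compact
    support of a partial sum the limit is as small as the remainder. *)
Lemma mollifier_series_C0 Om r (F : 'cV[R]_3 -> R) (c : nat -> R) (x : nat -> 'cV[R]_3) M :
  open Om -> 0 < r -> (forall k, inner Om r (x k)) -> 0 <= M ->
  (forall z N, `|F z - \sum_(k < N) c k * mollifier alpha r (x k - z)| <= M * 4^-1 ^+ N) ->
  C0_fun Om F.
Proof.
move=> oOm r0 xin M0 FS.
pose S N z := \sum_(k < N) c k * mollifier alpha r (x k - z).
have cS N : continuous (S N).
  move=> z; have FF : Filter (nbhs z) by exact: nbhs_filter.
  apply: cvg_big => [|k _]; first exact: add_continuous.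
  by apply: cvgM; [exact: cvg_cst|apply: continuous_subl; exact: mollifier_continuous].
split => [z _|e e0].
  apply: dist_continuous_at => e e0.
  have [N Ne] := small_quarter M0 (divr_gt0 e0 (ltr0n R 3)).
  have FF : Filter (nbhs z) by exact: nbhs_filter.
  have /cvgrPdist_le/(_ (e / 3)) := cS N z; rewrite divr_gt0// => /(_ isT).
  apply: filterS => w /= zw.
  have := FS z N; have := FS w N; rewrite -/(S N z) -/(S N w) distrC => Fw Fz.
  have -> : F z - F w = (F z - S N z) + ((S N z - S N w) + (S N w - F w)).
    by rewrite [S N z - _ + _]addrA subrK addrA subrK.
  apply: le_trans (ler_normD _ _) _; have := ler_normD (S N z - S N w) (S N w - F w).
  lra.
have [N Ne] := small_quarter M0 e0.
have [K [cK KOm K0]] : exists K, [/\ compact K, K `<=` Om & forall y, ~ K y -> S N y = 0].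
  elim: N {Ne} => [|N [K [cK KOm K0]]].
    exists set0; split => //; first exact: compact0.
    by move=> y _; rewrite /S big_ord0.
  have [K' [cK' K'Om K'0]] := mollifier_compact_support oOm r0 (xin N).
  exists (K `|` K'); split; first exact: compactU.
    by move=> y [/KOm|/K'Om].
  move=> y /not_orP[Ky K'y]; rewrite /S big_ord_recr /= -/(S N y) K0//.
  by rewrite K'0// mulr0 addr0.
exists K; split => // z _ Kz; have := FS z N.
by rewrite -/(S N z) K0// subr0 => /le_lt_trans; exact.
Qed.

End mollifiers.

(** * Uniform bounds on the singular convolutions *)

Section singular_convolution.
Context {R : realType} (Om : set 'cV[R]_3) (oOm : open Om).
Implicit Types (beta : 'cV[R]_3 -> R).

Lemma SBV_jump u : SBV Om u ->
  measurable (disc_set Om u : set (H2space R)) /\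
  forall i j, H2.-integrable (disc_set Om u : set (H2space R))
    (EFin \o (fun x => jump_tens u x i j)).
Proof. by case=> _ [F [_ mD iJ _]]; split. Qed.

Lemma conv_sing_continuous u beta M i j : SBV Om u -> continuous beta -> 0 <= M ->
  (forall z, `|beta z| <= M) -> continuous (fun x => conv_sing Om u beta x i j).
Proof.
move=> /SBV_jump[mD iJ] cb M0 bM.
have := convolution_continuous mD (iJ i j) measurable_H2_id cb M0 bM.
suff -> : (fun x => conv_sing Om u beta x i j) =
  (fun x : 'cV[R]_3 => \int[H2]_(y in (disc_set Om u : set (H2space R)))
    (beta (x - (y : 'cV[R]_3)) * jump_tens u y i j)) by [].
by apply/funext => x; rewrite mxE.
Qed.

(** [uniform_boundedness] for the pairings of D^s u_n with the kernels centred in [inner Om r]. For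
    fixed [n] the mass of D^s u_n gives a bound; convergence against each series of kernels makes it
    independent of [n]. *)
Lemma conv_sing_uniform_bound alpha (u : nat -> 'cV[R]_3 -> 'cV[R]_3) r i j :
  smooth alpha -> spt alpha `<=` eball 0 1 -> 0 < r ->
  (forall n, SBV Om (u n)) ->
  (forall phi, C0_fun Om phi -> cvgn (fun n => pair_sing Om (u n) phi i j)) ->
  exists M, forall n x, inner Om r x ->
    `|conv_sing Om (u n) (mollifier alpha r) x i j| <= M.
Proof.
move=> sa spta r0 uSBV cu.
pose beta := mollifier alpha r.
have [b b0 betab] : exists2 b, 0 <= b & forall z, `|beta z| <= b.
  exact: mollifier_bounded.
have cbeta : continuous beta by exact: mollifier_continuous.
pose Y := {x : 'cV[R]_3 | inner Om r x}.
pose D n : set (H2space R) := disc_set Om (u n).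
pose J n (z : H2space R) : R := jump_tens (u n) z i j.
have mD n : measurable (D n) by case: (SBV_jump (uSBV n)).
have iJ n : H2.-integrable (D n) (EFin \o J n).
  by case: (SBV_jump (uSBV n)) => _; exact.
pose a n (y : Y) := pair_sing Om (u n) (fun z => beta (sval y - z)) i j.
have mker n (y : Y) : measurable_fun (D n) (fun z : H2space R => beta (sval y - (z : 'cV[R]_3))).
  exact: (measurable_convolution_kernel (D := D n) measurable_H2_id (sval y) cbeta).
have [|c y c4|M aM] := @uniform_boundedness R Y a
    (fun n => b * \int[H2]_(z in D n) `|J n z|).
- move=> n y; exact: (pairing_bound (mD n) (iJ n) (mker n y) b0 _).2.
- have [F [FS Ftail]] := geometric_series_uniform (f := fun k z => beta (sval (y k) - z))
    b0 c4 (fun k z => betab _).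
  have F0 : C0_fun Om F.
    apply: (@mollifier_series_C0 R alpha sa spta Om r F c (sval \o y) (2 * b)) => //.
      by move=> k; exact: svalP.
    exact: mulr_ge0.
  (* A convergent sequence is bounded. This [M] depends on the series [F], which
     [uniform_boundedness] allows. *)
  have [M [_ /(_ (M + 1))]] := cvg_seq_bounded (cu F F0).
  rewrite ltrDl ltr01 => /(_ isT) TM.
  exists (M + 1) => n; exists (pair_sing Om (u n) F i j); split; first exact: TM.
  have -> : (fun k => \sum_(j0 < k) c j0 * a n (y j0)) =
      (fun k => \int[H2]_(z in D n) ((\sum_(l < k) c l * beta (sval (y l) - z)) * J n z)).
    apply/funext => k; rewrite (pairing_sum (mD n) (iJ n) c k (fun l => mker n (y l)) b0)//.
  (* The series [F] and its remainders are each at most 2 [b], so the partial sums are at most 4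
     [b]. *)
  apply: (pairing_cvg (mD n) (iJ n) (M := 4 * b)) => [k||k z _|z _].
  + apply: measurable_sum => l; apply: measurable_funM => //; exact: mker.
  + exact: mulr_ge0.
  + have := Ftail z k; have := Ftail z 0%N; rewrite big_ord0 subr0 expr0 mulr1.
    have q1 : (4^-1 ^+ k : R) <= 1.
      by rewrite exprn_ile1 ?invr_ge0// invf_le1// ler1n.
    have := ler_wpM2l (mulr_ge0 (ler0n R 2) b0) q1; rewrite mulr1.
    set s := \sum_(_ < _) _; move=> h1 h2 h3.
    have -> : s = F z - (F z - s) by rewrite opprB addrC subrK.
    by apply: le_trans (ler_normB _ _) _; lra.
  + exact: FS.
exists M => n x xin; rewrite mxE; exact: (aM n (exist _ x xin)).
Qed.

End singular_convolution.

(** * Approximation of the identity *)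

Section approximate_identity.
Context {R : realType} (alpha : 'cV[R]_3 -> R).
Context (sa : smooth alpha) (spta : spt alpha `<=` eball 0 1).
Context (alpha1 : \int[leb3]_(x in eball 0 1) alpha x = 1).

Let ca : continuous alpha. Proof. exact: sa 0%N. Qed.

(** The mass is prescribed on the unit ball, whereas the rescaling formula concerns the whole space;
    [alpha] vanishes off the ball. *)
Lemma spt_integrable : leb3.-integrable setT (EFin \o alpha) /\ \int[leb3]_x alpha x = 1.
Proof.
have mB : measurable (eball (0 : 'cV[R]_3) 1).
  by apply: open_measurable_colvec; exact: open_eball.
have aE : alpha = alpha \_ (eball 0 1).
  apply/funext => x; rewrite patchE; case: ifPn => // /negP xB.
  apply/eqP; apply: contrapT => /negP ax; apply: xB; rewrite inE; apply: spta.
  exact: (@subset_closure _ [set x | alpha x != 0]).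
split; last by rewrite aE -Rintegral_mkcond.
rewrite aE -restrict_EFin; apply/(integrable_mkcond _ mB).
have [M M0 aM] := smooth_spt_bounded sa spta.
apply: measurable_bounded_integrable => //.
- apply: (@leb3_bounded _ _ 1) => // x; rewrite /eball /= subr0 => /ltW.
  by apply: le_trans; exact: norm_le_enorm.
- by apply: open_continuous_measurable_colvec; [exact: open_eball|move=> x _; exact: ca].
- exists M; split; first exact: num_real.
  by move=> c Mc x _; apply: le_trans (ltW Mc).
Qed.

Lemma mollifier_mass r (x : 'cV[R]_3) : 0 < r ->
  [/\ leb3.-integrable setT (EFin \o (fun y => mollifier alpha r (x - y))),
      \int[leb3]_y mollifier alpha r (x - y) = 1 &
      \int[leb3]_y `|mollifier alpha r (x - y)| = \int[leb3]_z `|alpha z|].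
Proof.
move=> r0; have [ia a1] := spt_integrable.
have [im m1] := Rintegral_leb3_rescale x r0 ia.
have [_ ma] := Rintegral_leb3_rescale x r0 (integrable_abse ia).
split => //; first by rewrite -a1 -m1.
rewrite -ma; apply: eq_Rintegral => y _.
by rewrite /mollifier normrM ger0_norm// invr_ge0 exprn_ge0// ltW.
Qed.

(** The kernel vanishes at distance [r] or more from [x], so [h] has to be controlled only near [x].
    This serves for global bounds and for the local oscillation alike. *)
Lemma mollifier_pairing_bound r (x : 'cV[R]_3) (h : 'cV[R]_3 -> R) c : 0 < r -> 0 <= c ->
  measurable_fun setT h -> (forall y, enorm (y - x) < r -> `|h y| <= c) ->
  leb3.-integrable setT (EFin \o (fun y => mollifier alpha r (x - y) * h y)) /\
  `|\int[leb3]_y (mollifier alpha r (x - y) * h y)| <= c * \int[leb3]_z `|alpha z|.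
Proof.
move=> r0 c0 mh hc; have [im _ <-] := mollifier_mass x r0.
apply: le_Rintegral_bound => //.
  apply: measurable_funM => //; apply: open_continuous_measurable_colvec; first exact: openT.
  by move=> y _; apply: continuous_subl; exact: mollifier_continuous.
move=> y _; rewrite normrM mulrC.
have [->|m0] := eqVneq (mollifier alpha r (x - y)) 0; first by rewrite normr0 !mulr0.
by rewrite ler_wpM2r// hc// enormB; exact: mollifier_support m0.
Qed.

Lemma mollifier_approx (x : 'cV[R]_3) (h : 'cV[R]_3 -> R) c e :
  measurable_fun setT h -> (forall y, `|h y| <= c) -> {for x, continuous h} -> 0 < e ->
  exists2 d, 0 < d & forall r, 0 < r -> r < d ->
    `|h x - \int[leb3]_y (mollifier alpha r (x - y) * h y)| <= e.
Proof.
move=> mh hc ch e0; have c0 : 0 <= c := le_trans (normr_ge0 _) (hc x).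
set A := \int[leb3]_z `|alpha z|.
have A0 : 0 <= A by apply: Rintegral_ge0.
(* [A + 1] is positive as soon as [A] is nonnegative, and [A / (A + 1)] is at most 1. *)
have e'0 : 0 < e / (A + 1) by rewrite divr_gt0// ltr_wpDl.
have [d d0 dP] : exists2 d, 0 < d & eball x d `<=` [set y | `|h x - h y| <= e / (A + 1)].
  apply/nbhs_eballP; have FF : Filter (nbhs x) by exact: nbhs_filter.
  by have /cvgrPdist_le/(_ _ e'0) := ch.
exists d => // r r0 rd; have [im m1 _] := mollifier_mass x r0.
have [imh _] := mollifier_pairing_bound (x := x) r0 c0 mh (fun y _ => hc y).
have imx : leb3.-integrable setT (EFin \o (fun y => mollifier alpha r (x - y) * h x)).
  have := integrableZr measurableT (h x) im.
  by apply: eq_integrable => // y _ /=; rewrite EFinM.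
have -> : h x - \int[leb3]_y (mollifier alpha r (x - y) * h y) =
    \int[leb3]_y (mollifier alpha r (x - y) * (h x - h y)).
  rewrite -[X in X - _]mul1r -m1 -RintegralZr// -RintegralB//.
  by apply: eq_Rintegral => y _; rewrite mulrBr.
have [||_ le_e] := @mollifier_pairing_bound r x (fun y => h x - h y) (e / (A + 1)) r0 (ltW e'0).
- exact: measurable_funB.
- by move=> y xy; apply: dP; exact: lt_trans xy rd.
apply: le_trans le_e _; rewrite -/A mulrAC ler_pdivrMr ?ltr_wpDl//.
by apply: ler_wpM2l; [exact: ltW|rewrite lerDl].
Qed.

End approximate_identity.

(** * Mollification of a bounded continuous field on [Om] *)

Section continuous_tensor.
Context {R : realType} (Om : set 'cV[R]_3) (oOm : open Om).
Context (H : 'cV[R]_3 -> 'M[R]_3) (cH : forall x, Om x -> {for x, continuous H}).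
Context (MH : R) (MH0 : 0 <= MH) (HM : forall x, Om x -> `|H x| <= MH).
Context (leb_Om : (leb3 Om < +oo)%E).

Let mOm : measurable Om. Proof. exact: open_measurable_colvec. Qed.

Lemma entry_continuous_at (F : 'cV[R]_3 -> 'M[R]_3) (x : 'cV[R]_3) i j :
  {for x, continuous F} -> {for x, continuous (fun y : 'cV[R]_3 => F y i j)}.
Proof.
move=> cF; have FF : Filter (nbhs x) by exact: nbhs_filter.
have cE : F y i j @[y --> x] --> F x i j by apply: cvg_entry; exact: cF.
exact: cE.
Qed.

Lemma entry_integrable i j : leb3.-integrable Om (EFin \o (fun y => H y i j)).
Proof.
apply: measurable_bounded_integrable => //.
  apply: open_continuous_measurable_colvec => // x Omx.
  have := entry_continuous_at (i := i) (j := j) (cH Omx). exact.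
exists MH; split; first exact: num_real.
move=> c Mc x Omx; apply: le_trans (ltW Mc); apply: le_trans (HM Omx).
exact: entry_le_norm.
Qed.

Lemma conv_ac_continuous beta M i j : continuous beta -> 0 <= M ->
  (forall z, `|beta z| <= M) -> continuous (fun x => conv_ac Om H beta x i j).
Proof.
move=> cb M0 bM.
have mid : measurable_fun [set: 'cV[R]_3] (fun x : 'cV[R]_3 => x) by exact: measurable_id.
have := convolution_continuous mOm (entry_integrable i j) mid cb M0 bM.
suff -> : (fun x => conv_ac Om H beta x i j) =
  (fun x : 'cV[R]_3 => \int[leb3]_(y in Om) (beta (x - y) * H y i j)) by [].
by apply/funext => x; rewrite mxE.
Qed.

(** Extension by zero turns the convolution over [Om] into one over R^3; as [Om] is open, continuity
    at its points survives. *)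
Let H0 i j := (fun y => H y i j) \_ Om.

Let mH0 i j : measurable_fun setT (H0 i j).
Proof.
apply/(measurable_restrictT _ mOm).
apply: open_continuous_measurable_colvec => // x Omx.
  have := entry_continuous_at (i := i) (j := j) (cH Omx). exact.
Qed.

Let H0M i j y : `|H0 i j y| <= MH.
Proof.
rewrite /H0 patchE; case: ifPn => [/set_mem/HM|_]; last by rewrite normr0.
by apply: le_trans; exact: entry_le_norm.
Qed.

Let conv_acE beta x i j :
  conv_ac Om H beta x i j = \int[leb3]_y (beta (x - y) * H0 i j y).
Proof.
rewrite mxE /pair_ac Rintegral_mkcond; apply: eq_Rintegral => y _.
by rewrite /H0 !patchE; case: ifP => _; rewrite ?mulr0.
Qed.

Context (alpha : 'cV[R]_3 -> R) (sa : smooth alpha) (spta : spt alpha `<=` eball 0 1).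
Context (alpha1 : \int[leb3]_(x in eball 0 1) alpha x = 1).

(** The bound involves neither [r] nor [x], so it yields a dominating constant for r -> 0. *)
Lemma conv_ac_bound r x i j : 0 < r ->
  `|conv_ac Om H (mollifier alpha r) x i j| <= MH * \int[leb3]_z `|alpha z|.
Proof.
move=> r0; rewrite conv_acE.
exact: (mollifier_pairing_bound (x := x) sa spta alpha1 r0 MH0 (mH0 i j) (fun y _ => H0M i j y)).2.
Qed.

Lemma conv_ac_cvg (r : nat -> R) x : Om x -> (forall n, 0 < r n) ->
  r n @[n --> \oo] --> 0 ->
  conv_ac Om H (mollifier alpha (r n)) x @[n --> \oo] --> H x.
Proof.
move=> Omx r0 rcvg; apply: cvg_mx => i j; apply/cvgrPdist_le => e e0.
have H0x y : Om y -> H0 i j y = H y i j by move=> Omy; rewrite /H0 patchE mem_set.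
have cH0 : {for x, continuous (H0 i j)}.
  apply: dist_continuous_at => e' e'0; have FF : Filter (nbhs x) by exact: nbhs_filter.
  have /cvgrPdist_le/(_ _ e'0) := entry_continuous_at (i := i) (j := j) (cH Omx).
  move=> near_x; have Omn : nbhs x Om by exact: open_nbhs_nbhs.
  by apply: filterS2 Omn near_x => y Omy /=; rewrite !H0x.
have [d d0 dP] := mollifier_approx sa spta alpha1 (mH0 i j) (H0M i j) cH0 e0.
have /cvgrPdist_lt/(_ _ d0) := rcvg; apply: filterS => n; rewrite sub0r normrN.
by rewrite gtr0_norm// => rd; rewrite conv_acE -H0x//; exact: dP.
Qed.

End continuous_tensor.

(** * Energies *)

Section densities.
Context {R : realType} (Om : set 'cV[R]_3) (oOm : open Om).
Context (Psi : 'M[R]_3 -> R) (lPsi : lipschitz Psi) (g : 'cV[R]_3 -> 'cV[R]_3).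
Context (cL : forall x, Om x -> {for x, continuous (fun y => invmx (grad g y))}).
Context (ML : R) (ML0 : 0 <= ML) (LM : forall x, Om x -> `|invmx (grad g x)| <= ML).

Lemma density_cvg (T : Type) (F : set_system T) (FF : Filter F) x
    (C : T -> 'M[R]_3) (B : 'M[R]_3) :
  C t @[t --> F] --> B -> Psi_of Psi g x (C t) @[t --> F] --> Psi_of Psi g x B.
Proof.
move=> CB.
have cm : invmx (grad g x) *m C t @[t --> F] --> invmx (grad g x) *m B.
  by apply: cvg_mulmx CB; exact: cvg_cst.
exact: lipschitz_cvg lPsi cm.
Qed.

Lemma density_measurable (C : 'cV[R]_3 -> 'M[R]_3) :
  (forall x, Om x -> {for x, continuous C}) ->
  measurable_fun Om (fun x => Psi_of Psi g x (C x)).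
Proof.
move=> cC; apply: open_continuous_measurable_colvec => // x Omx.
have FF : Filter (nbhs x) by exact: nbhs_filter.
have cm : invmx (grad g y) *m C y @[y --> x] --> invmx (grad g x) *m C x.
  by apply: cvg_mulmx; [exact: cL|exact: cC].
exact: lipschitz_cvg lPsi cm.
Qed.

Lemma density_measurable_entry (C : 'cV[R]_3 -> 'M[R]_3) :
  (forall i j, continuous (fun x => C x i j)) ->
  measurable_fun Om (fun x => Psi_of Psi g x (C x)).
Proof.
move=> cC; apply: density_measurable => x _; have FF : Filter (nbhs x) by exact: nbhs_filter.
have cCx : C y @[y --> x] --> C x by apply: cvg_mx => i j; exact: cC.
exact: cCx.
Qed.

(** Linear growth of a Lipschitz function from its value at 0; the 3 comes from the sup norm of a
    product of matrices. A single [c] provides the dominating constants of both limits. *)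
Lemma density_bound : exists c : R -> R, (forall M, 0 <= M -> 0 <= c M) /\
  forall x (B : 'M[R]_3) (M : R), Om x -> 0 <= M -> (forall i j, `|B i j| <= M) ->
    `|Psi_of Psi g x B| <= c M.
Proof.
have [k k0 Psik] := lipschitz_le lPsi.
exists (fun M => `|Psi 0| + k * (3 * (ML * M))); split => [M M0|x B M Omx M0 BM].
  by rewrite addr_ge0// !mulr_ge0.
have -> : Psi_of Psi g x B = Psi 0 + (Psi_of Psi g x B - Psi 0) by rewrite addrC subrK.
apply: le_trans (ler_normD _ _) _; rewrite lerD2l.
apply: le_trans (Psik _ _ I I) _; rewrite subr0 ler_wpM2l//.
apply: le_trans (norm_mulmx_le _ _) _; rewrite ler_wpM2l// ler_pM//; first exact: LM.
exact: norm_le_entry.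
Qed.

End densities.

(** * Algebra of [Mmx] and frame-indifference *)

Section matrix_kinematics.
Context {R : realType}.
Implicit Types A B Q : 'M[R]_3.

Lemma Mmx_mulmx A B : A \in unitmx -> invmx A *m (A - B) = Mmx A B.
Proof. by move=> uA; rewrite mulmxBr mulVmx. Qed.

(** The factor Q cancels in (Q A)^-1 (Q B) = A^-1 B. *)
Lemma Mmx_frame_indifferent Q A B : Q^T *m Q = 1%:M -> A \in unitmx ->
  Mmx (Q *m A) (Q *m B) = Mmx A B.
Proof.
move=> QQ uA; rewrite /Mmx /Kmx; congr (_ - _).
have uQ : Q \in unitmx by case/mulmx1_unit : QQ.
have uQA : Q *m A \in unitmx by rewrite unitmx_mul uQ.
apply: (can_inj (mulKmx uQA)); rewrite mulKVmx// -mulmxA mulKVmx//.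
Qed.

End matrix_kinematics.

Theorem theorem6p2 (R : realType) (Om : set 'cV[R]_3)
    (N : nat) (s m : 'I_N -> 'cV[R]_3) (p : 'I_N -> R)
    (Psi : 'M[R]_3 -> R) (alpha : 'cV[R]_3 -> R) :
  open Om -> bounded_set Om -> connected Om -> lipschitz_boundary Om ->
  (forall a, [/\ enorm (s a) = 1, enorm (m a) = 1 & dot (s a) (m a) = 0]) ->
  (forall a, 0 < p a) ->
  lipschitz Psi -> sublinear_growth Psi -> slip_periodic s m p Psi ->
  smooth alpha -> spt alpha `<=` eball 0 1 ->
  \int[leb3]_(x in eball 0 1) alpha x = 1 ->
  forall (g : 'cV[R]_3 -> 'cV[R]_3) (G : 'cV[R]_3 -> 'M[R]_3),
  crystallographic s m Om g G ->
  let Ialpha (r : R) := \int[leb3]_(x in inner Om r)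
    Psi_of Psi g x
      (conv_ac Om (fun y => grad g y - G y) (mollifier alpha r) x) in
  let I := \int[leb3]_(x in Om) Psi_of Psi g x (grad g x - G x) in
  [/\ forall u, Ad Om g G u ->
        (forall r : R, 0 < r ->
           energy Om alpha Psi g r (u n) @[n --> \oo] --> Ialpha r) /\
        upscaled_energy Om alpha Psi g u r @[r --> 0^'+] --> I,
      Ialpha r @[r --> 0^'+] --> I,
      [/\ I = \int[leb3]_(x in Om) Psi (1%:M - invmx (grad g x) *m G x),
          I = \int[leb3]_(x in Om) Psi (1%:M - K_pair g G x) &
          I = \int[leb3]_(x in Om) Psi (M_pair g G x)],
      forall Q, rotation Q -> forall x, Om x ->
        Psi (Mmx (Q *m grad g x) (Q *m G x)) = Psi (M_pair g G x) &
      slip_periodic s m p Psi /\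
      (forall a b (xi : R) (t : 'cV[R]_3) (F F' H H' : 'M[R]_3),
         dot t (m a) = 0 -> F \in unitmx -> F' \in unitmx ->
         Mmx F H = tens t (m a) + xi *: tens (cross (m a) (m b)) (m b) ->
         Mmx F' H' = tens (t + p a *: s a) (m a) +
                     xi *: tens (cross (m a) (m b)) (m b) ->
         Psi (Mmx F' H') = Psi (Mmx F H))].
Proof.
move=> oOm bOm _ _ _ _ lPsi _ perPsi sa spta alpha1 g G
  [[_ [[_ [_ cg _ _]] lg lig] [cG uG] detg] _] Ialpha I.
(* The equality of determinants transfers invertibility from [G] to [grad g]. *)
have gunit x : Om x -> grad g x \in unitmx.
  by move=> Omx; rewrite unitmxE detg// -unitmxE uG//; exact: subset_closure.
have mOm : measurable Om by exact: open_measurable_colvec.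
have [Mb OmMb] : exists M, forall x, Om x -> `|x| <= M.
  by case: bOm => c [_ /(_ (c + 1))]; rewrite ltrDl ltr01 => /(_ isT); exists (c + 1).
have Omfin : (leb3 Om < +oo)%E by exact: leb3_bounded OmMb.
have [ML ML0 LM] := lipschitz_bounded bOm lig.
have [Mg Mg0 gM] := lipschitz_bounded bOm lg.
have [MG MG0 GM] : exists2 M, 0 <= M & forall x, Om x -> `|G x| <= M.
  have cpt : compact (closure Om).
    apply: (@bounded_closed_compact_col _ _ _ Mb); last exact: closed_closure.
    have cB : closed [set x : 'cV[R]_3 | `|x| <= Mb].
      apply: (@closed_comp _ _ (fun x : 'cV[R]_3 => `|x|) [set y | y <= Mb]).
        by move=> x _; exact: norm_continuous.
      exact: closed_le.
    have := closure_subset OmMb; rewrite -((closure_id _).1 cB).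
    by move=> h x /h.
  have [M [_ /(_ (M + 1))]] := compact_bounded (continuous_compact cG cpt).
  rewrite ltrDl ltr01 => /(_ isT) GM; exists `|M + 1| => // x Omx.
  by apply: le_trans (ler_norm _); apply: GM; exists x => //; exact: subset_closure.
have cGx x : Om x -> {for x, continuous G}.
  move=> Omx; have h := continuous_subspaceW (@subset_closure _ Om) cG.
  by rewrite (continuous_open_subspace _ oOm) in h; exact: h (mem_set Omx).
have cL x : Om x -> {for x, continuous (fun y => invmx (grad g y))}.
  by move=> Omx; exact: lipschitz_continuous_at oOm Omx lig.
pose H x := grad g x - G x.
have cH x : Om x -> {for x, continuous H}.
  move=> Omx; have FF : Filter (nbhs x) by exact: nbhs_filter.
  have cHx : grad g y - G y @[y --> x] --> grad g x - G x.
    by apply: cvgB; [case: (cg x Omx)|exact: cGx].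
  exact: cHx.
have MH0 : 0 <= Mg + MG by exact: addr_ge0.
have HM x : Om x -> `|H x| <= Mg + MG.
  by move=> Omx; apply: le_trans (ler_normB _ _) _; rewrite lerD ?gM ?GM.
have [c [c0 cM]] := density_bound lPsi ML0 LM.
have mfin r : measurable (inner Om r) /\ inner Om r `<=` Om.
  split; first by apply: open_measurable_colvec; exact: open_inner.
  by move=> x [].
have icst M A : measurable A -> A `<=` Om -> leb3.-integrable A (EFin \o (fun=> M : R)).
  move=> mA AOm; have Afin : (leb3 A < +oo)%E.
    by apply: (leb3_bounded mA) => x /AOm; exact: OmMb.
  exact: (measurable_bounded_integrable mA Afin (measurable_cst _) (bounded_cst _ _)).
have energy_cvg u : Ad Om g G u -> forall r, 0 < r ->
    energy Om alpha Psi g r (u n) @[n --> \oo] --> Ialpha r.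
  move=> [uSBV _ _ using_] r r0; have [mA AOm] := mfin r.
  have [b b0 betab] := mollifier_bounded sa spta r.
  have cbeta := mollifier_continuous sa (r := r).
  have gdisc : disc_set Om g = set0.
    apply: (disc_set_continuous oOm) => x Omx.
    by apply: differentiable_continuous; case: (cg x Omx).
  have sing_cvg phi : C0_fun Om phi -> forall i j,
      pair_sing Om (u n) phi i j @[n --> \oo] --> pair_ac Om H phi i j.
    move=> /using_ h i j; move: (h i j).
    rewrite [pair_sing Om g _ _ _](_ : _ = 0) ?addr0//.
    by rewrite /pair_sing gdisc Rintegral_set0.
  have /choice[M PM] : forall p : 'I_3 * 'I_3, exists M, forall n x, inner Om r x ->
      `|conv_sing Om (u n) (mollifier alpha r) x p.1 p.2| <= M.
    move=> [i j]; apply: conv_sing_uniform_bound => // phi /sing_cvg h.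
    by apply/cvg_ex; eexists; exact: h.
  (* The bounds are obtained entry by entry; their sum is one constant for all nine. *)
  pose MM := \sum_p `|M p|; have MM0 : 0 <= MM by apply: sumr_ge0.
  have MMP n x i j : inner Om r x ->
      `|conv_sing Om (u n) (mollifier alpha r) x i j| <= MM.
    move=> xin; apply: le_trans (PM (i, j) n x xin) _; apply: le_trans (ler_norm _) _.
    by rewrite /MM (bigD1 (i, j))//= lerDl sumr_ge0.
  apply: (Rdominated_convergence mA _ _ (icst (c MM) _ mA AOm) _).2.
  - move=> n; apply: (measurable_funS mOm AOm).
    apply: (density_measurable_entry oOm lPsi cL) => i j.
    by apply: conv_sing_continuous (uSBV n) cbeta b0 betab.
  - move=> x xin; apply: density_cvg => //; apply: cvg_mx => i j.
    have := sing_cvg _ (mollifier_C0 sa spta oOm r0 xin) i j.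
    rewrite [conv_ac _ _ _ _ _ _]mxE.
    by under [X in _ -> X @ _ --> _]eq_fun do rewrite mxE.
  - by move=> n x xin; apply: cM => //; [exact: AOm|move=> i j; exact: MMP].
have Ialpha_cvg (r : nat -> R) : (forall n, 0 < r n) /\ (r n @[n --> \oo] --> 0) ->
    Ialpha (r n) @[n --> \oo] --> I.
  move=> [r0 rcvg]; set M := (Mg + MG) * \int[leb3]_z `|alpha z|.
  have M0 : 0 <= M by rewrite mulr_ge0// Rintegral_ge0.
  pose f n := fun x => Psi_of Psi g x (conv_ac Om H (mollifier alpha (r n)) x).
  (* The domain moves with [n]; cutting the integrand off by zero puts all integrals on [Om]. *)
  have IE n : Ialpha (r n) = \int[leb3]_(x in Om) (f n \_ (inner Om (r n))) x.
    by rewrite -Rintegral_mkcondr setIidr//; case: (mfin (r n)).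
  have fM n x : Om x -> `|(f n \_ (inner Om (r n))) x| <= c M.
    move=> Omx; rewrite patchE; case: ifPn => _; last by rewrite normr0 c0.
    by apply: cM => // i j; exact: conv_ac_bound.
  under eq_fun do rewrite IE.
  apply: (Rdominated_convergence mOm _ _ (icst (c M) _ mOm _) fM).2 => //.
  - move=> n; apply/measurable_restrict => //; first by case: (mfin (r n)).
    apply: (measurable_funS mOm (@subIsetl _ _ _)).
    have [b b0 betab] := mollifier_bounded sa spta (r n).
    have cbeta : continuous (mollifier alpha (r n)) by exact: mollifier_continuous.
    apply: (density_measurable_entry oOm lPsi cL) => i j.
    exact: (conv_ac_continuous oOm cH HM Omfin cbeta b0 betab).
  - move=> x Omx; have [d d0 dP] := near_inner oOm Omx.
    have cfx : f n x @[n --> \oo] --> Psi_of Psi g x (H x).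
      have cc := conv_ac_cvg oOm cH MH0 HM sa spta alpha1 Omx r0 rcvg.
      by apply: density_cvg => //; exact: cc.
    apply: cvg_trans cfx; apply: near_eq_cvg.
    have /cvgrPdist_lt/(_ _ d0) := rcvg; apply: filterS => n.
    rewrite sub0r normrN gtr0_norm// => rd.
    by rewrite patchE mem_set//; exact: dP.
(* A one-sided limit in the reals may be tested on positive null sequences, where dominated
   convergence applies. *)
have Ialpha_cvg0 : Ialpha r @[r --> 0^'+] --> I.
  by apply/cvg_at_rightP => r; exact: Ialpha_cvg.
have Mmx_int : I = \int[leb3]_(x in Om) Psi (M_pair g G x).
  apply: eq_Rintegral => x /set_mem Omx.
  by rewrite /Psi_of Mmx_mulmx// gunit.
split => //.
- move=> u uAd; split; first exact: energy_cvg.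
  apply/cvg_at_rightP => r rP; have := Ialpha_cvg r rP.
  (* For each radius [r n] > 0 the limit of the energies exists and is unique, so [limn] returns
     it. *)
  suff -> : (fun n => Ialpha (r n)) = (fun n => upscaled_energy Om alpha Psi g u (r n)) by [].
  apply/funext => n; apply/esym/cvg_lim => //; apply: energy_cvg => //.
  by case: rP.
- by move=> Q [QQ _] x Omx; rewrite Mmx_frame_indifferent// gunit.
- split => // a b xi t F F' H1 H2 ta _ _ -> ->; exact: perPsi.
Qed.
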